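(* Let $\mathsf{B}_1=B(t_1,x_1,y_1,t_2,x_2,y_2,v_1)$ and $\mathsf{B}_2=B(t_3,x_3,y_3,t_4,x_4,y_4,v_2)$ be two non-empty beads. If $\mathsf{B}_1\cap\mathsf{B}_2\neq\emptyset$, $\tau\mathsf{B}_1\cap\mathsf{B}_2=\emptyset$, $\mathsf{B}_1\cap\tau\mathsf{B}_2=\emptyset$, $\rho\mathsf{B}_1\cap\partial\mathsf{B}_2=\emptyset$ and $\rho\mathsf{B}_2\cap\partial\mathsf{B}_1=\emptyset$, then $\mathrm{IC}(C^-_1,C^-_2)\subseteq\mathsf{B}_1\cap\mathsf{B}_2$ or $\mathrm{IC}(C^+_1,C^+_2)\subseteq\mathsf{B}_1\cap\mathsf{B}_2$.
   Context: For $p=(t_p,x_p,y_p)$, $q=(t_q,x_q,y_q)$ with $t_p\le t_q$ and $v_{\max}\ge0$, the bead $B(t_p,x_p,y_p,t_q,x_q,y_q,v_{\max})$ is the set of $(t,x,y)\in\mathbb{R}^3$ with $(x-x_p)^2+(y-y_p)^2\le (t-t_p)^2v_{\max}^2$, $(x-x_q)^2+(y-y_q)^2\le (t_q-t)^2v_{\max}^2$, $t_p\le t\le t_q$; it is non-empty iff $(x_q-x_p)^2+(y_q-y_p)^2\le (t_q-t_p)^2v_{\max}^2$. Its apex set is $\tau B=\{p,q\}$; its mantel $\partial B$ is its topological boundary. Its rim $\rho B$ is the set of $(t,x,y)$ with $(x-x_p)^2+(y-y_p)^2=(t-t_p)^2v_{\max}^2$, $t_p\le t\le t_q$, and $2x(x_p-x_q)+x_q^2-x_p^2+2y(y_p-y_q)+y_q^2-y_p^2=v_{\max}^2\bigl(2t(t_p-t_q)+t_q^2-t_p^2\bigr)$.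 For a point $(s,a,b)$ and speed $v$, the bottom cone is $C^-(s,a,b,v)=\{(t,x,y):(x-a)^2+(y-b)^2=(t-s)^2v^2,\ s\le t\}$ and the upper cone is $C^+(s,a,b,v)=\{(t,x,y):(x-a)^2+(y-b)^2=(s-t)^2v^2,\ t\le s\}$. Here $C^-_1=C^-(t_1,x_1,y_1,v_1)$, $C^-_2=C^-(t_3,x_3,y_3,v_2)$, $C^+_1=C^+(t_2,x_2,y_2,v_1)$, $C^+_2=C^+(t_4,x_4,y_4,v_2)$. The initial contact $\mathrm{IC}(C^-(s_1,a_1,b_1,w_1),C^-(s_2,a_2,b_2,w_2))$ is the set of points $(t,x,y)$ with $s_1\le t$, $s_2\le t$, $(x-a_1)^2+(y-b_1)^2=(t-s_1)^2w_1^2$, $(x-a_2)^2+(y-b_2)^2=(t-s_2)^2w_2^2$ and $\bigl((t-s_1)w_1+(t-s_2)w_2\bigr)^2=(a_1-a_2)^2+(b_1-b_2)^2$ (a single point when neither apex lies inside the other cone); $\mathrm{IC}(C^+(s_1,a_1,b_1,w_1),C^+(s_2,a_2,b_2,w_2))$ is defined the same way with $s_1\le t,\ s_2\le t$ replaced by $t\le s_1,\ t\le s_2$. *)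

(* Defs.v *)
From mathcomp Require Import all_boot all_order all_algebra.
From mathcomp Require Import all_classical all_reals all_analysis.
Set Implicit Arguments.
Unset Strict Implicit.
Unset Printing Implicit Defensive.
Import Order.TTheory GRing.Theory Num.Theory.
Import numFieldNormedType.Exports.
Local Open Scope classical_set_scope.
Local Open Scope ring_scope.

(* Space-time points are triples (t, x, y), time first, in [R * R * R] with
   its product topology. *)

Definition boundary (T : topologicalType) (A : set T) : set T :=
  closure A `\` interior A.

Definition bead (R : realType) (tp xp yp tq xq yq v : R) : set (R * R * R) :=
  [set u | let: (t, x, y) := u in
    [/\ (x - xp) ^+ 2 + (y - yp) ^+ 2 <= (t - tp) ^+ 2 * v ^+ 2,
        (x - xq) ^+ 2 + (y - yq) ^+ 2 <= (tq - t) ^+ 2 * v ^+ 2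
      & tp <= t <= tq]].

Definition bead_apexes (R : realType) (tp xp yp tq xq yq : R) :
    set (R * R * R) :=
  [set (tp, xp, yp); (tq, xq, yq)].

(* The last equation is the difference of the equations of the two cones, i.e.
   the plane in which the bottom and upper cones meet. *)
Definition bead_rim (R : realType) (tp xp yp tq xq yq v : R) :
    set (R * R * R) :=
  [set u | let: (t, x, y) := u in
    [/\ (x - xp) ^+ 2 + (y - yp) ^+ 2 = (t - tp) ^+ 2 * v ^+ 2,
        tp <= t <= tq
      & 2 * x * (xp - xq) + xq ^+ 2 - xp ^+ 2
          + 2 * y * (yp - yq) + yq ^+ 2 - yp ^+ 2
        = v ^+ 2 * (2 * t * (tp - tq) + tq ^+ 2 - tp ^+ 2)]].

(* The bottom cone opens towards the future of its apex, the upper cone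
   towards the past. *)
Definition bottom_cone (R : realType) (s a b v : R) : set (R * R * R) :=
  [set u | let: (t, x, y) := u in
    (x - a) ^+ 2 + (y - b) ^+ 2 = (t - s) ^+ 2 * v ^+ 2 /\ s <= t].

Definition upper_cone (R : realType) (s a b v : R) : set (R * R * R) :=
  [set u | let: (t, x, y) := u in
    (x - a) ^+ 2 + (y - b) ^+ 2 = (s - t) ^+ 2 * v ^+ 2 /\ t <= s].

(* Points whose time is one at which the signed radii of the two discs add up to the distance
   between their centers, i.e. at which the discs touch from outside. *)
Definition tangency_times (R : realType) (s1 a1 b1 w1 s2 a2 b2 w2 : R) :
    set (R * R * R) :=
  [set u | let: (t, _, _) := u in
    ((t - s1) * w1 + (t - s2) * w2) ^+ 2 = (a1 - a2) ^+ 2 + (b1 - b2) ^+ 2].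

Definition bottom_IC (R : realType) (s1 a1 b1 w1 s2 a2 b2 w2 : R) :
    set (R * R * R) :=
  bottom_cone s1 a1 b1 w1 `&` bottom_cone s2 a2 b2 w2
    `&` tangency_times s1 a1 b1 w1 s2 a2 b2 w2.

Definition upper_IC (R : realType) (s1 a1 b1 w1 s2 a2 b2 w2 : R) :
    set (R * R * R) :=
  upper_cone s1 a1 b1 w1 `&` upper_cone s2 a2 b2 w2
    `&` tangency_times s1 a1 b1 w1 s2 a2 b2 w2.

(* Main.v *)
Require Import Defs.
From mathcomp Require Import all_boot all_order all_algebra.
From mathcomp Require Import all_classical all_reals all_analysis.
From mathcomp Require Import ring lra.
Import Order.TTheory GRing.Theory Num.Theory.
Import numFieldNormedType.Exports.
Local Open Scope classical_set_scope.
Local Open Scope ring_scope.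
Set Implicit Arguments.
Unset Strict Implicit.

(* Beads are convex, so the intersection of the two beads has a lowest and a
   highest point in time. At the lowest point m no cone of one bead can be
   active together with both cones of the other (rims avoid mantels). Trying to
   move m further down leaves two possibilities: either exactly the two bottom
   cones are active, and then m is their initial contact, or the bottom cone of
   the faster bead touches the upper cone of the slower one from outside.
   Dually for the highest point M and the upper cones. If no initial contact
   lies in the intersection, the faster bead crosses the slower one, entering
   at m and leaving at M. Each rim then has a point outside the other bead, so
   by connectedness each rim lies entirely outside the other bead. As m and M
   lie on opposite sides of both rim planes, in opposite order, convexity
   yields a common point of the two beads on both rim planes. Following the
   line in which these planes meet, the first exit from one of the beads is a
   rim point of that bead inside the other one, a contradiction. *)

(** * The Euclidean norm of the plane *)

Definition enorm (R : realType) (x y : R) : R := Num.sqrt (x ^+ 2 + y ^+ 2).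

Lemma enorm_ge0 (R : realType) (x y : R) : 0 <= enorm x y.
Proof. exact: sqrtr_ge0. Qed.

Lemma enorm_sqr (R : realType) (x y : R) : enorm x y ^+ 2 = x ^+ 2 + y ^+ 2.
Proof. by rewrite sqr_sqrtr // addr_ge0 ?sqr_ge0. Qed.

Lemma enorm_le (R : realType) (x y r : R) :
  0 <= r -> (enorm x y <= r) = (x ^+ 2 + y ^+ 2 <= r ^+ 2).
Proof. by move=> r0; rewrite -enorm_sqr ler_sqr ?nnegrE ?enorm_ge0. Qed.

Lemma enorm_eq (R : realType) (x y r : R) :
  0 <= r -> (enorm x y = r) <-> (x ^+ 2 + y ^+ 2 = r ^+ 2).
Proof.
move=> r0; split=> [<-|e]; first by rewrite enorm_sqr.
by rewrite /enorm e sqrtr_sqr ger0_norm.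
Qed.

Lemma enorm_eq0 (R : realType) (x y : R) : enorm x y <= 0 -> x = 0 /\ y = 0.
Proof.
rewrite enorm_le // expr0n /= => h.
have x0 := sqr_ge0 x; have y0 := sqr_ge0 y.
have /eqP : x ^+ 2 = 0 by lra.
have /eqP : y ^+ 2 = 0 by lra.
by rewrite !sqrf_eq0 => /eqP-> /eqP->.
Qed.

Lemma enorm0 (R : realType) : enorm 0 0 = 0 :> R.
Proof. by rewrite /enorm expr0n addr0 sqrtr0. Qed.

Lemma enormN (R : realType) (x y : R) : enorm (- x) (- y) = enorm x y.
Proof. by rewrite /enorm !sqrrN. Qed.

Lemma enormB (R : realType) (x y x' y' : R) :
  enorm (x - x') (y - y') = enorm (x' - x) (y' - y).
Proof. by rewrite -enormN !opprB. Qed.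

Lemma enormZ (R : realType) (k x y : R) :
  0 <= k -> enorm (k * x) (k * y) = k * enorm x y.
Proof.
move=> k0; apply/enorm_eq; first by rewrite mulr_ge0 ?enorm_ge0.
by rewrite [RHS]exprMn enorm_sqr; ring.
Qed.

(** Cauchy-Schwarz: the difference of the squares is [(x * y' - y * x') ^+ 2]. *)
Lemma enorm_dot (R : realType) (x y x' y' : R) :
  x * x' + y * y' <= enorm x y * enorm x' y'.
Proof.
have n0 : 0 <= enorm x y * enorm x' y' by rewrite mulr_ge0 ?enorm_ge0.
have [h|h] := leP (x * x' + y * y') 0; first exact: le_trans n0.
rewrite -ler_sqr ?nnegrE ?(ltW h)//.
rewrite [leRHS]exprMn !enorm_sqr; have := sqr_ge0 (x * y' - y * x'); nra.
Qed.

Lemma enormD (R : realType) (x y x' y' : R) :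
  enorm (x + x') (y + y') <= enorm x y + enorm x' y'.
Proof.
rewrite enorm_le ?addr_ge0 ?enorm_ge0//.
have := enorm_dot x y x' y'; have := enorm_sqr x y; have := enorm_sqr x' y'.
nra.
Qed.

Lemma enorm_tri (R : realType) (a b c d x y : R) :
  enorm (a - c) (b - d) <= enorm (a - x) (b - y) + enorm (x - c) (y - d).
Proof.
have := enormD (a - x) (b - y) (x - c) (y - d).
by congr (enorm _ _ <= _); ring.
Qed.

(** * Space-time points, cones as sublevel sets, and beads *)

Notation pt R := (R * R * R)%type.
Notation tm u := (u.1.1).

(* Signed speeds cover both kinds of cones: the solid bottom cone of speed [v]
   and apex [p] is [gap v p <= 0], the solid upper one [gap (- v) p <= 0]. *)
Definition gap (R : realType) (w : R) (p u : pt R) : R :=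
  enorm (u.1.2 - p.1.2) (u.2 - p.2) - w * (tm u - tm p).

Definition dist (R : realType) (p q : pt R) : R :=
  enorm (q.1.2 - p.1.2) (q.2 - p.2).

Definition mix (R : realType) (u u' : pt R) (e : R) : pt R :=
  ((1 - e) * tm u + e * tm u',
   (1 - e) * u.1.2 + e * u'.1.2, (1 - e) * u.2 + e * u'.2).

(** A norm plus an affine function of time is convex. All convexity of beads comes from here. *)
Lemma gap_mix (R : realType) (w : R) (p u u' : pt R) (e : R) :
  0 <= e <= 1 -> gap w p (mix u u' e) <= (1 - e) * gap w p u + e * gap w p u'.
Proof.
move=> /andP[e0 e1]; rewrite /gap /mix /=.
have := enormD ((1 - e) * (u.1.2 - p.1.2)) ((1 - e) * (u.2 - p.2))
  (e * (u'.1.2 - p.1.2)) (e * (u'.2 - p.2)).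
rewrite !enormZ ?subr_ge0// => h.
rewrite (_ : _ + _ - p.1.2 = (1 - e) * (u.1.2 - p.1.2) + e * (u'.1.2 - p.1.2));
  last by ring.
rewrite (_ : _ + _ - p.2 = (1 - e) * (u.2 - p.2) + e * (u'.2 - p.2));
  last by ring.
lra.
Qed.

Lemma gap_mix_le0 (R : realType) (w : R) (p u u' : pt R) (e : R) :
  0 <= e <= 1 -> gap w p u <= 0 -> gap w p u' <= 0 ->
  gap w p (mix u u' e) <= 0.
Proof.
move=> e01 h h'; apply: le_trans (gap_mix _ _ _ _ e01) _.
case/andP: e01 => *; nra.
Qed.

Lemma gap_self (R : realType) (w : R) (p : pt R) : gap w p p = 0.
Proof. by rewrite /gap !subrr enorm0 mulr0 subrr. Qed.

Lemma dist_ge0 (R : realType) (p q : pt R) : 0 <= dist p q.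
Proof. exact: enorm_ge0. Qed.

Lemma distC (R : realType) (p q : pt R) : dist p q = dist q p.
Proof. exact: enormB. Qed.

Lemma dist_tri (R : realType) (p q u : pt R) :
  dist p q <= dist p u + dist u q.
Proof. by rewrite addrC; exact: enorm_tri. Qed.

Lemma gapE (R : realType) (w : R) (p u : pt R) :
  gap w p u = dist p u - w * (tm u - tm p).
Proof. by []. Qed.

(** Square roots replace the squares of [bead], so that each solid cone is a sublevel set of a
    convex function. *)
Definition inbead (R : realType) (v : R) (p q u : pt R) : Prop :=
  [/\ gap v p u <= 0, gap (- v) q u <= 0 & tm p <= tm u <= tm q].

Lemma beadP (R : realType) (tp xp yp tq xq yq v : R) (u : pt R) : 0 <= v ->
  bead tp xp yp tq xq yq v u <-> inbead v (tp, xp, yp) (tq, xq, yq) u.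
Proof.
case: u => -[t x] y v0; rewrite /bead /inbead /gap /=.
split=> -[h1 h2 /andP[h3 h4]]; (split; last by rewrite h3 h4).
- by rewrite subr_le0 enorm_le ?mulr_ge0 ?subr_ge0// exprMn mulrC.
- rewrite (_ : - v * (t - tq) = v * (tq - t)); last by ring.
  by rewrite subr_le0 enorm_le ?mulr_ge0 ?subr_ge0// exprMn mulrC.
- by move: h1; rewrite subr_le0 enorm_le ?mulr_ge0 ?subr_ge0// exprMn mulrC.
- move: h2; rewrite (_ : - v * (t - tq) = v * (tq - t)); last by ring.
  by rewrite subr_le0 enorm_le ?mulr_ge0 ?subr_ge0// exprMn mulrC.
Qed.

(** * Active cones at the lowest common point *)

Lemma inbead_mix (R : realType) (v : R) (p q u u' : pt R) (e : R) :
  0 <= e <= 1 -> inbead v p q u -> inbead v p q u' -> inbead v p q (mix u u' e).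
Proof.
move=> e01 [h1 h2 /andP[h3 h4]] [k1 k2 /andP[k3 k4]].
split; [exact: gap_mix_le0|exact: gap_mix_le0|rewrite /mix /=].
by case/andP: e01 => e0 e1; apply/andP; split; nra.
Qed.

(** At the time of its apex a solid bottom cone shrinks to that apex. *)
Lemma inbead_first (R : realType) (v : R) (p q u : pt R) :
  inbead v p q u -> u <> p -> tm p < tm u.
Proof.
case=> h _ /andP[h1 _] up; rewrite lt_neqAle h1 andbT; apply/eqP => e.
apply: up; move: h; rewrite /gap e subrr mulr0 subr0 => /enorm_eq0[].
move=> /eqP; rewrite subr_eq0 => /eqP ex /eqP; rewrite subr_eq0 => /eqP ey.
by case: u p e ex ey {h1} => -[? ?] ? [[? ?] ?] /= -> -> ->.
Qed.

(** Each pair holds the values of a convex constraint at the two ends of a segment. A constraint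
    with slack at the first end survives a short step, even if it fails at the other end; an active
    one must hold at the other end too. *)
Lemma small_weight (R : realType) (s : seq (R * R)) :
  all (fun c => (c.1 <= 0) && ((c.1 < 0) || (c.2 <= 0))) s ->
  exists2 e0 : R, 0 < e0 <= 1 &
    forall e, 0 < e <= e0 ->
      all (fun c => (1 - e) * c.1 + e * c.2 <= 0) s.
Proof.
elim: s => [_|[f f'] s IH /= /andP[/andP[f0 ff'] /IH[e0 /andP[e0p e01] he0]]].
  by exists 1; rewrite ?ltr01 ?lexx.
have [f'0|f'0] := leP f' 0.
  exists e0; rewrite ?e0p// => e ee0; rewrite he0// andbT.
  by case/andP: ee0 => *; nra.
have fn : f < 0 by case/orP: ff' => //; rewrite leNgt f'0.
(* The second bound is the weight at which the interpolation between [f] and [f'] vanishes. *)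
exists (Num.min e0 (- f / (f' - f))).
  rewrite lt_min e0p ge_min e01 /= andbT; apply: divr_gt0; lra.
move=> e /andP[ep]; rewrite le_min => /andP[ee0].
rewrite ler_pdivlMr; last by lra.
by move=> he; rewrite he0 ?ep// andbT; lra.
Qed.

(** Only the cones active at [m] have to contain the earlier point [k]; a short step from [m]
    towards [k] then stays in both beads. The bottom time bounds have slack at [m], and the top ones
    cannot be violated by going down. *)
Lemma descend (R : realType) (v1 v2 : R) (p1 p2 p3 p4 m k : pt R) :
  inbead v1 p1 p2 m -> inbead v2 p3 p4 m ->
  tm p1 < tm m -> tm p3 < tm m -> tm k < tm m ->
  (gap v1 p1 m < 0) || (gap v1 p1 k <= 0) ->
  (gap (- v1) p2 m < 0) || (gap (- v1) p2 k <= 0) ->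
  (gap v2 p3 m < 0) || (gap v2 p3 k <= 0) ->
  (gap (- v2) p4 m < 0) || (gap (- v2) p4 k <= 0) ->
  exists u, [/\ inbead v1 p1 p2 u, inbead v2 p3 p4 u & tm u < tm m].
Proof.
move=> [m1 m2 /andP[_ m12]] [m3 m4 /andP[_ m34]] tm1 tm3 tmk k1 k2 k3 k4.
have [|e /andP[e0 e1] /(_ e)] := @small_weight R
  [:: (gap v1 p1 m, gap v1 p1 k); (gap (- v1) p2 m, gap (- v1) p2 k);
      (gap v2 p3 m, gap v2 p3 k); (gap (- v2) p4 m, gap (- v2) p4 k);
      (tm p1 - tm m, tm p1 - tm k); (tm p3 - tm m, tm p3 - tm k)].
  rewrite /= k1 k2 k3 k4 m1 m2 m3 m4 /= !subr_lt0 tm1 tm3 !subr_le0.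
  by rewrite (ltW tm1) (ltW tm3).
rewrite e0 lexx /= => /(_ isT) /and5P[h1 h2 h3 h4 /and3P[h5 h6 _]].
have e01 : 0 <= e <= 1 by rewrite ltW.
exists (mix m k e); split; last by rewrite /mix /=; nra.
- split; [exact: le_trans (gap_mix _ _ _ _ e01) _
    |exact: le_trans (gap_mix _ _ _ _ e01) _|rewrite /mix /=].
  by apply/andP; split; nra.
- split; [exact: le_trans (gap_mix _ _ _ _ e01) _
    |exact: le_trans (gap_mix _ _ _ _ e01) _|rewrite /mix /=].
  by apply/andP; split; nra.
Qed.

(** The two cones cut discs out of the plane of time [t]. The point dividing the segment between the
    centres in the ratio of the radii lies in both discs. *)
Lemma disks_meet (R : realType) (w w' : R) (p p' : pt R) (t : R) :
  0 <= w * (t - tm p) -> 0 <= w' * (t - tm p') ->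
  dist p p' <= w * (t - tm p) + w' * (t - tm p') ->
  exists k, [/\ tm k = t, gap w p k <= 0 & gap w' p' k <= 0].
Proof.
rewrite /gap; set r := w * _; set r' := w' * _ => r0 r'0 d.
(* With both radii zero the ratio is undefined, but the centres coincide. *)
have [s0|s0] := leP (r + r') 0.
  have [r00 r'00] : r = 0 /\ r' = 0 by split; lra.
  exists (t, p.1.2, p.2) => /=; rewrite -/r -/r' !subrr enorm0; split=> //.
    by rewrite r00 subr0.
  by rewrite r'00 subr0 enormB; rewrite r00 r'00 addr0 in d.
set l := r / (r + r').
have l0 : 0 <= l by rewrite divr_ge0 // ltW.
have l1 : 0 <= 1 - l by rewrite subr_ge0 ler_pdivrMr// mul1r; lra.
have lr : l * (r + r') = r by rewrite divfK // gt_eqF.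
exists (t, p.1.2 + l * (p'.1.2 - p.1.2), p.2 + l * (p'.2 - p.2)) => /=.
rewrite -/r -/r'; split=> //.
  rewrite [X in enorm X]addrC [X in enorm _ X]addrC !addKr enormZ//.
  by rewrite /dist in d; nra.
rewrite enormB (_ : p'.1.2 - _ = (1 - l) * (p'.1.2 - p.1.2)); last by ring.
rewrite (_ : p'.2 - _ = (1 - l) * (p'.2 - p.2)); last by ring.
rewrite enormZ//; rewrite /dist in d; nra.
Qed.

(** If the affine function is negative at [a], its zero lies between [a] and [t] and serves as
    witness; otherwise [a] does. *)
Lemma affine_earlier (R : realType) (a t c d : R) : a < t -> 0 < c * t + d ->
  exists2 t', a <= t' < t & 0 <= c * t' + d.
Proof.
move=> at_ h; have [ha|ha] := leP 0 (c * a + d).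
  by exists a; rewrite ?lexx.
have c0 : 0 < c by nra.
exists (- d / c); last by rewrite mulrCA divff ?gt_eqF// mulr1 addNr.
by rewrite ler_pdivlMr// ltr_pdivrMr//; apply/andP; split; lra.
Qed.

(** The form in which the disjointness of a rim and a mantel is used; [bead_rim_apart] derives
    it. *)
Definition rim_apart (R : realType) (v : R) (p q : pt R)
    (v' : R) (p' q' : pt R) : Prop :=
  forall u, inbead v p q u -> inbead v' p' q' u ->
    gap v p u = 0 -> gap (- v) q u = 0 ->
    gap v' p' u < 0 /\ gap (- v') q' u < 0.

Definition lowest_common (R : realType) (v1 v2 : R) (p1 p2 p3 p4 m : pt R) :=
  [/\ inbead v1 p1 p2 m, inbead v2 p3 p4 m &
      forall u, inbead v1 p1 p2 u -> inbead v2 p3 p4 u -> tm m <= tm u].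

Lemma lowest_commonC (R : realType) (v1 v2 : R) (p1 p2 p3 p4 m : pt R) :
  lowest_common v1 v2 p1 p2 p3 p4 m -> lowest_common v2 v1 p3 p4 p1 p2 m.
Proof. by case=> m1 m2 mm; split=> // u u1 u2; exact: mm. Qed.

(** Excludes patterns of active cones: it suffices to exhibit an earlier [k] inside every cone
    active at [m]. *)
Lemma lowest_descend (R : realType) (v1 v2 : R) (p1 p2 p3 p4 m k : pt R) :
  lowest_common v1 v2 p1 p2 p3 p4 m ->
  tm p1 < tm m -> tm p3 < tm m -> tm k < tm m ->
  (gap v1 p1 m < 0) || (gap v1 p1 k <= 0) ->
  (gap (- v1) p2 m < 0) || (gap (- v1) p2 k <= 0) ->
  (gap v2 p3 m < 0) || (gap v2 p3 k <= 0) ->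
  (gap (- v2) p4 m < 0) || (gap (- v2) p4 k <= 0) -> False.
Proof.
move=> [m1 m2 mm] a1 a3 ak h1 h2 h3 h4.
have [u [u1 u2]] := descend m1 m2 a1 a3 ak h1 h2 h3 h4.
by rewrite ltNge mm.
Qed.

(** If [v1 <= v2], going from [m] back to [p1] stays within the upper cone of [p4], so a step
    towards [p1] descends. If the discs overlapped properly at [m], they would still meet slightly
    earlier. *)
Lemma lowest_bottom_upper (R : realType) (v1 v2 : R) (p1 p2 p3 p4 m : pt R) :
  0 <= v1 -> 0 <= v2 ->
  lowest_common v1 v2 p1 p2 p3 p4 m ->
  tm p1 < tm m -> tm p3 < tm m -> gap (- v1) p2 p1 <= 0 ->
  gap v1 p1 m = 0 -> gap (- v1) p2 m < 0 ->
  gap v2 p3 m < 0 -> gap (- v2) p4 m = 0 ->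
  v2 < v1 /\ dist p1 p4 = v1 * (tm m - tm p1) - v2 * (tm m - tm p4).
Proof.
move=> v10 v20 lm a1 a3 n1 m1 m2 m3 m4.
have tri := dist_tri p1 p4 m; move: (m1) (m4); rewrite !gapE => e1 e4.
rewrite (distC m) in tri.
have [_ [_ _ /andP[_ a4]] _] := lm.
have v21 : v2 < v1.
  rewrite ltNge; apply/negP => v12.
  apply: (lowest_descend lm a1 a3 a1).
  - by rewrite gap_self lexx orbT.
  - by rewrite n1 orbT.
  - by rewrite m3.
  - by apply/orP; right; rewrite gapE distC; nra.
split=> //; apply/eqP; rewrite eq_le; apply/andP; split; first by lra.
rewrite leNgt; apply/negP => lt_d.
(* The affine function is the sum of the radii of the two discs minus the distance between their
   centres. *)
have [] := @affine_earlier R (tm p1) (tm m) (v1 - v2)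
  (v2 * tm p4 - v1 * tm p1 - dist p1 p4) a1; first by lra.
move=> t' /andP[t1 t2] ht'.
have [||| k [kt k1 k4]] := @disks_meet R v1 (- v2) p1 p4 t'; [nra|nra|lra|].
apply: (lowest_descend lm a1 a3 (_ : tm k < tm m)); rewrite ?kt//.
- by rewrite k1 orbT.
- by rewrite m2.
- by rewrite m3.
- by rewrite k4 orbT.
Qed.

Lemma lowest_bottom_bottom (R : realType) (v1 v2 : R) (p1 p2 p3 p4 m : pt R) :
  0 <= v1 -> 0 <= v2 ->
  lowest_common v1 v2 p1 p2 p3 p4 m ->
  tm p1 < tm m -> tm p3 < tm m ->
  gap v1 p1 m = 0 -> gap (- v1) p2 m < 0 ->
  gap v2 p3 m = 0 -> gap (- v2) p4 m < 0 ->
  0 < v1 + v2 /\ dist p1 p3 = v1 * (tm m - tm p1) + v2 * (tm m - tm p3).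
Proof.
move=> v10 v20 lm a1 a3 m1 m2 m3 m4.
have tri := dist_tri p1 p3 m; move: (m1) (m3); rewrite !gapE => e1 e3.
rewrite (distC m) in tri.
have vp : 0 < v1 + v2.
  rewrite ltNge; apply/negP => v12.
  have [v1z v2z] : v1 = 0 /\ v2 = 0 by split; lra.
  (* At speed zero the gaps do not depend on time, so going straight down keeps both bottom cones
     satisfied. *)
  apply: (@lowest_descend R _ _ _ _ _ _ _ (tm m - 1, m.1.2, m.2) lm a1 a3).
  - by rewrite /= gtrBl.
  - by apply/orP; right; rewrite -m1 v1z /gap !mul0r.
  - by rewrite m2.
  - by apply/orP; right; rewrite -m3 v2z /gap !mul0r.
  - by rewrite m4.
split=> //; apply/eqP; rewrite eq_le; apply/andP; split; first by lra.
rewrite leNgt; apply/negP => lt_d.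
(* Times after both apexes keep both radii non-negative. *)
have a13 : Num.max (tm p1) (tm p3) < tm m by rewrite gt_max a1.
have [] := @affine_earlier R _ (tm m) (v1 + v2)
  (- v2 * tm p3 - v1 * tm p1 - dist p1 p3) a13; first by lra.
move=> t' /andP[+ t2] ht'; rewrite ge_max => /andP[t1 t3].
have [||| k [kt k1 k3]] := @disks_meet R v1 v2 p1 p3 t'; [nra|nra|lra|].
apply: (lowest_descend lm a1 a3 (_ : tm k < tm m)); rewrite ?kt//.
- by rewrite k1 orbT.
- by rewrite m2.
- by rewrite k3 orbT.
- by rewrite m4.
Qed.

(* At [m] only the bottom cone of the bead [v, p, q] and the upper cone of the
   bead [v', p', q'] are active, and their discs at time [tm m] touch from
   outside. *)
Definition bottom_upper_touch (R : realType) (v : R) (p q : pt R)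
    (v' : R) (p' q' m : pt R) : Prop :=
  [/\ gap v p m = 0, gap (- v) q m < 0, gap v' p' m < 0, gap (- v') q' m = 0 &
      dist p q' = v * (tm m - tm p) - v' * (tm m - tm q')].

(** There are sixteen patterns of active cones. Three or more active cones contradict the rim
    hypotheses. If one bead has no active cone, a step towards the bottom apex of the other bead
    descends. If exactly the two upper cones are active, going straight down works. The three
    patterns left are the cases listed. *)
Lemma lowest_cases (R : realType) (v1 v2 : R) (p1 p2 p3 p4 m : pt R) :
  0 <= v1 -> 0 <= v2 ->
  lowest_common v1 v2 p1 p2 p3 p4 m ->
  ~ inbead v2 p3 p4 p1 -> ~ inbead v1 p1 p2 p3 ->
  gap (- v1) p2 p1 <= 0 -> gap (- v2) p4 p3 <= 0 ->
  rim_apart v1 p1 p2 v2 p3 p4 -> rim_apart v2 p3 p4 v1 p1 p2 ->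
  [\/ [/\ 0 < v1 + v2, gap v1 p1 m = 0, gap v2 p3 m = 0 &
          dist p1 p3 = v1 * (tm m - tm p1) + v2 * (tm m - tm p3)],
      v2 < v1 /\ bottom_upper_touch v1 p1 p2 v2 p3 p4 m
    | v1 < v2 /\ bottom_upper_touch v2 p3 p4 v1 p1 p2 m].
Proof.
move=> v10 v20 lm ap1 ap3 n1 n2 ra1 ra2.
have [b1 b2 _] := lm.
have a1 : tm p1 < tm m by apply: inbead_first b1 _ => e; apply: ap1; rewrite -e.
have a3 : tm p3 < tm m by apply: inbead_first b2 _ => e; apply: ap3; rewrite -e.
have [m1 m2 _] := b1; have [m3 m4 _] := b2.
have lm' := lowest_commonC lm.
have R1 := ra1 m b1 b2; have R2 := ra2 m b2 b1.
move: m1 m2 m3 m4; rewrite !le_eqVlt.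
case/predU1P => [m1|m1] /predU1P[m2|m2] /predU1P[m3|m3] /predU1P[m4|m4].
all: try by (case: (R1 m1 m2) => *; lra).
all: try by (case: (R2 m3 m4) => *; lra).
all: try by (exfalso; apply: (lowest_descend lm a1 a3 a1);
  rewrite ?gap_self ?lexx ?n1 ?m3 ?m4 ?orbT).
all: try by (exfalso; apply: (lowest_descend lm a1 a3 a3);
  rewrite ?gap_self ?lexx ?n2 ?m1 ?m2 ?orbT).
- by constructor 1;
    have [] := lowest_bottom_bottom v10 v20 lm a1 a3 m1 m2 m3 m4.
- by constructor 2;
    have [] := lowest_bottom_upper v10 v20 lm a1 a3 n1 m1 m2 m3 m4.
- by constructor 3;
    have [] := lowest_bottom_upper v20 v10 lm' a3 a1 n2 m3 m4 m1 m2.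
exfalso.
apply: (@lowest_descend R _ _ _ _ _ _ _ (tm m - 1, m.1.2, m.2) lm a1 a3).
- by rewrite /= gtrBl.
- by rewrite m1.
- by apply/orP; right; move: m2; rewrite /gap /=; lra.
- by rewrite m3.
- by apply/orP; right; move: m4; rewrite /gap /=; lra.
Qed.

(** * Rims *)

(** The ends may come in either order, since [rim_outside] joins two angles of unknown order; the
    zero is located only for [a <= b]. *)
Lemma continuous_zero (R : realType) (f : R -> R) (a b : R) :
  continuous f -> f a <= 0 -> 0 <= f b ->
  exists2 c, f c = 0 & a <= b -> a <= c <= b.
Proof.
move=> cf fa fb; have cw A : {within A, continuous f}.
  exact: continuous_subspaceT.
have [ab|ba] := leP a b.
  have [|c] := IVT ab (cw _) (v := 0).
    by rewrite ge_min fa /= le_max fb orbT.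
  by rewrite in_itv /= => cab fc; exists c.
have [|c _ fc] := IVT (ltW ba) (cw _) (v := 0).
  by rewrite ge_min fa orbT /= le_max fb.
by exists c.
Qed.

Definition continuous_coords (R : realType) (T : topologicalType)
    (g : T -> pt R) : Prop :=
  [/\ continuous (fun s => tm (g s) : R), continuous (fun s => (g s).1.2 : R) &
      continuous (fun s => (g s).2 : R)].

Lemma gap_continuous (R : realType) (T : topologicalType) (w : R) (p : pt R)
    (g : T -> pt R) :
  continuous_coords g -> continuous (fun s => gap w p (g s) : R).
Proof.
case=> c1 c2 c3 s; rewrite /gap /enorm.
apply: cvgB; last first.
  by apply: cvgM; [exact: cvg_cst|apply: cvgB; [exact: c1|exact: cvg_cst]].
have cX : {for s, continuous (fun s => (g s).1.2 - p.1.2 : R)}.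
  by apply: cvgB; [exact: c2|exact: cvg_cst].
have cY : {for s, continuous (fun s => (g s).2 - p.2 : R)}.
  by apply: cvgB; [exact: c3|exact: cvg_cst].
exact: continuous_comp (cvgD (cvgM cX cX) (cvgM cY cY)) (@sqrt_continuous R _).
Qed.

(** At positive speed the cones force the time bounds, because norms are non-negative. *)
Lemma inbeadE (R : realType) (v : R) (p q u : pt R) : 0 < v ->
  inbead v p q u <-> gap v p u <= 0 /\ gap (- v) q u <= 0.
Proof.
move=> v0; split=> [[]//|[h1 h2]]; split=> //.
have n1 := enorm_ge0 (u.1.2 - p.1.2) (u.2 - p.2).
have n2 := enorm_ge0 (u.1.2 - q.1.2) (u.2 - q.2).
rewrite /gap in h1 h2.
by apply/andP; split; rewrite -subr_ge0 -(pmulr_rge0 _ v0); lra.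
Qed.

(** The intermediate value theorem for the maximum of the two gaps, which is non-positive exactly on
    the bead. *)
Lemma bead_exit (R : realType) (v : R) (p q : pt R) (g : R -> pt R) (a b : R) :
  0 < v -> continuous_coords g -> inbead v p q (g a) -> ~ inbead v p q (g b) ->
  exists c, [/\ inbead v p q (g c), gap v p (g c) = 0 \/ gap (- v) q (g c) = 0
    & a <= b -> a <= c <= b].
Proof.
move=> v0 cg /(inbeadE _ _ _ v0)[a1 a2] nb.
have cf : continuous (fun s => Num.max (gap v p (g s)) (gap (- v) q (g s)) : R).
  move=> s; have c1 := @gap_continuous R _ v p g cg s.
  by have c2 := @gap_continuous R _ (- v) q g cg s;
    exact: (continuous_max c1 c2).
have [||c fc cab] := continuous_zero (a := a) (b := b) cf.
- by rewrite ge_max a1 a2.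
- rewrite leNgt gt_max; apply/negP => /andP[b1 b2]; apply: nb.
  by apply/inbeadE => //; split; exact: ltW.
exists c; split=> //.
  apply/inbeadE => //; have : Num.max (gap v p (g c)) (gap (- v) q (g c)) <= 0.
    by rewrite fc.
  by rewrite ge_max => /andP[].
by move: fc; case: (leP (gap v p (g c)) (gap (- v) q (g c))) => _ ->;
  [right|left].
Qed.

Lemma mix_continuous (R : realType) (u u' : pt R) :
  continuous_coords (mix u u').
Proof.
have aff (x y : R) : continuous (fun s : R => (1 - s) * x + s * y).
  move=> s; apply: cvgD; apply: cvgM; try exact: cvg_cst; last exact: cvg_id.
  by apply: cvgB; [exact: cvg_cst|exact: cvg_id].
by split; exact: aff.
Qed.

(** The quadratic form of the full double cone, which ignores the sign of [w]. On the half with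
    [0 <= w * (tm u - tm p)] it vanishes exactly where [gap w p] does. *)
Definition cone2 (R : realType) (w : R) (p u : pt R) : R :=
  (u.1.2 - p.1.2) ^+ 2 + (u.2 - p.2) ^+ 2 - w ^+ 2 * (tm u - tm p) ^+ 2.

Lemma cone2_eq0 (R : realType) (w : R) (p u : pt R) :
  0 <= w * (tm u - tm p) -> gap w p u = 0 <-> cone2 w p u = 0.
Proof.
move=> h; rewrite /gap /cone2; split=> /eqP; rewrite subr_eq0 => /eqP.
  by move/(enorm_eq _ _ h) => ->; rewrite exprMn subrr.
by rewrite -exprMn => /(enorm_eq _ _ h) ->; rewrite subrr.
Qed.

Lemma cone2_lt0 (R : realType) (w : R) (p u : pt R) :
  0 <= w * (tm u - tm p) -> gap w p u < 0 -> cone2 w p u < 0.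
Proof.
move=> h; rewrite /gap /cone2 !subr_lt0 -exprMn -enorm_sqr.
by rewrite ltr_sqr ?nnegrE// enorm_ge0.
Qed.

(* Affine in [u], since the quadratic parts of the two cones agree. *)
Definition rim_plane (R : realType) (v : R) (p q u : pt R) : R :=
  cone2 v q u - cone2 v p u.

Lemma rim_plane_mix (R : realType) (v : R) (p q u u' : pt R) (e : R) :
  rim_plane v p q (mix u u' e) =
  (1 - e) * rim_plane v p q u + e * rim_plane v p q u'.
Proof. by rewrite /rim_plane /cone2 /mix /=; ring. Qed.

Lemma cone2N (R : realType) (w : R) (p u : pt R) :
  cone2 (- w) p u = cone2 w p u.
Proof. by rewrite /cone2 sqrrN. Qed.

(** On the rim plane the two quadratic forms agree, so one cone is active only together with the
    other. *)
Lemma rim_plane_rim (R : realType) (v : R) (p q u : pt R) : 0 <= v ->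
  inbead v p q u -> rim_plane v p q u = 0 ->
  gap v p u = 0 \/ gap (- v) q u = 0 ->
  gap v p u = 0 /\ gap (- v) q u = 0.
Proof.
move=> v0 [_ _ /andP[h1 h2]] /eqP; rewrite subr_eq0 => /eqP e.
have s1 : 0 <= v * (tm u - tm p) by rewrite mulr_ge0 ?subr_ge0.
have s2 : 0 <= - v * (tm u - tm q) by nra.
case=> [/(cone2_eq0 s1)|/(cone2_eq0 s2)] c.
  by split; [apply/cone2_eq0|apply/(cone2_eq0 s2); rewrite cone2N e].
by rewrite cone2N in c; split;
  [apply/cone2_eq0; rewrite // -e|apply/(cone2_eq0 s2); rewrite cone2N].
Qed.

(** * The rim as a curve parametrised by directions *)

Definition ray (R : realType) (v : R) (p : pt R) (c d s : R) : pt R :=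
  (tm p + s, p.1.2 + v * s * c, p.2 + v * s * d).

(** Along a generator of the cone of [p], the form [cone2 v q] is affine in the elapsed time
    ([cone2_ray]); this is its zero. *)
Definition rim_time (R : realType) (v : R) (p q : pt R) (c d : R) : R :=
  ((v * (tm q - tm p)) ^+ 2 - dist p q ^+ 2) /
  (2 * v * (v * (tm q - tm p) - (c * (q.1.2 - p.1.2) + d * (q.2 - p.2)))).

(** For positive [v] this makes the denominator of [rim_time] positive in every direction. *)
Definition nondegenerate (R : realType) (v : R) (p q : pt R) : Prop :=
  dist p q < v * (tm q - tm p).

Lemma unit_dot_le (R : realType) (c d x y : R) : c ^+ 2 + d ^+ 2 = 1 ->
  c * x + d * y <= enorm x y.
Proof.
move=> cd; have := enorm_dot c d x y.
by rewrite (_ : enorm c d = 1) ?mul1r// /enorm cd sqrtr1.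
Qed.

Lemma gap_ray (R : realType) (v : R) (p : pt R) (c d s : R) :
  0 <= v * s -> c ^+ 2 + d ^+ 2 = 1 -> gap v p (ray v p c d s) = 0.
Proof.
move=> vs cd; apply/cone2_eq0; first by rewrite /= addrAC subrr add0r.
rewrite /cone2 /ray /=.
transitivity (v ^+ 2 * s ^+ 2 * (c ^+ 2 + d ^+ 2 - 1)); first by ring.
by rewrite cd subrr mulr0.
Qed.

(** The terms quadratic in [s] cancel, because the ray runs at the speed of the cone. *)
Lemma cone2_ray (R : realType) (v : R) (p q : pt R) (c d s : R) :
  c ^+ 2 + d ^+ 2 = 1 ->
  cone2 v q (ray v p c d s) = dist p q ^+ 2 - (v * (tm q - tm p)) ^+ 2 +
    s * (2 * v * (v * (tm q - tm p) - (c * (q.1.2 - p.1.2) + d * (q.2 - p.2)))).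
Proof.
move=> cd; rewrite /dist enorm_sqr /cone2 /ray /=.
(* Inserting the factor [c ^+ 2 + d ^+ 2] turns the claim into a polynomial identity. *)
have -> : v ^+ 2 = v ^+ 2 * (c ^+ 2 + d ^+ 2) by rewrite cd mulr1.
transitivity ((q.1.2 - p.1.2) ^+ 2 + (q.2 - p.2) ^+ 2 -
  (v ^+ 2 * (c ^+ 2 + d ^+ 2)) * (tm q - tm p) ^+ 2 +
  s * (2 * v * (v * (c ^+ 2 + d ^+ 2) * (tm q - tm p)
    - (c * (q.1.2 - p.1.2) + d * (q.2 - p.2))))); first by ring.
by rewrite cd; ring.
Qed.

Lemma rim_denom (R : realType) (v : R) (p q : pt R) (c d : R) :
  0 < v -> nondegenerate v p q -> c ^+ 2 + d ^+ 2 = 1 ->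
  0 < 2 * v * (v * (tm q - tm p) - (c * (q.1.2 - p.1.2) + d * (q.2 - p.2))).
Proof.
move=> v0 pr cd; have := unit_dot_le (q.1.2 - p.1.2) (q.2 - p.2) cd.
rewrite -/(dist p q) /nondegenerate in pr * => h.
by rewrite !mulr_gt0// subr_gt0; lra.
Qed.

Lemma rim_time_gt0 (R : realType) (v : R) (p q : pt R) (c d : R) :
  0 < v -> nondegenerate v p q -> c ^+ 2 + d ^+ 2 = 1 -> 0 < rim_time v p q c d.
Proof.
move=> v0 pr cd; rewrite divr_gt0 ?rim_denom// subr_gt0.
have d0 := dist_ge0 p q.
by rewrite ltr_sqr ?nnegrE// (le_trans d0)// ltW.
Qed.

(** Clearing the denominator leaves [(v * T) ^+ 2 - 2 * (v * T) * k + D ^+ 2 >= 0]. As [k <= D], the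
    left side is at least [(v * T - D) ^+ 2]. *)
Lemma rim_time_le (R : realType) (v : R) (p q : pt R) (c d : R) :
  0 < v -> nondegenerate v p q -> c ^+ 2 + d ^+ 2 = 1 ->
  rim_time v p q c d <= tm q - tm p.
Proof.
move=> v0 pr cd; rewrite ler_pdivrMr ?rim_denom//.
have h := unit_dot_le (q.1.2 - p.1.2) (q.2 - p.2) cd.
rewrite -/(dist p q) in h; have d0 := dist_ge0 p q.
rewrite /nondegenerate in pr.
set T := tm q - tm p in pr *; set D := dist p q in h pr d0 *.
set k := _ + _ in h *.
have : (v * T) * k <= (v * T) * D by rewrite ler_wpM2l// (le_trans d0)// ltW.
have := sqr_ge0 (v * T - D); nra.
Qed.

Lemma ray_rim (R : realType) (v : R) (p q : pt R) (c d : R) :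
  0 < v -> nondegenerate v p q -> c ^+ 2 + d ^+ 2 = 1 ->
  let r := ray v p c d (rim_time v p q c d) in
  [/\ inbead v p q r, gap v p r = 0 & gap (- v) q r = 0].
Proof.
move=> v0 pr cd r; have s0 := rim_time_gt0 v0 pr cd.
have s1 := rim_time_le v0 pr cd.
have g1 : gap v p r = 0 by apply: gap_ray => //; rewrite mulr_ge0 ?ltW.
have g2 : gap (- v) q r = 0.
  apply/cone2_eq0; first by rewrite /r /=; nra.
  rewrite cone2N /r cone2_ray// divfK ?gt_eqF ?rim_denom//; ring.
by split=> //; apply/inbeadE => //; rewrite g1 g2.
Qed.

(** An affine function of positive slope has one zero. With [gap0_ray] this puts every rim point
    other than the bottom apex on the parametrised curve. *)
Lemma rim_ray (R : realType) (v : R) (p q u : pt R) (c d s : R) :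
  0 < v -> nondegenerate v p q -> c ^+ 2 + d ^+ 2 = 1 ->
  u = ray v p c d s -> tm u <= tm q -> gap (- v) q u = 0 ->
  s = rim_time v p q c d.
Proof.
move=> v0 pr cd -> uq /cone2_eq0; rewrite cone2N cone2_ray// => h.
have D0 := rim_denom v0 pr cd.
apply: (mulIf (lt0r_neq0 D0)); rewrite divfK ?gt_eqF//.
have /h : 0 <= - v * (tm (ray v p c d s) - tm q) by nra.
by lra.
Qed.

Lemma gap0_ray (R : realType) (v : R) (p u : pt R) :
  0 < v -> tm p < tm u -> gap v p u = 0 ->
  exists c d, c ^+ 2 + d ^+ 2 = 1 /\ u = ray v p c d (tm u - tm p).
Proof.
move=> v0 pu g; set s := tm u - tm p; have s0 : 0 < s by rewrite subr_gt0.
have vs0 : v * s != 0 by rewrite mulf_neq0// gt_eqF.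
exists ((u.1.2 - p.1.2) / (v * s)), ((u.2 - p.2) / (v * s)); split.
  have vs : 0 <= v * (tm u - tm p) by rewrite mulr_ge0 ?ltW.
  have /eqP := (cone2_eq0 vs).1 g; rewrite subr_eq0 -/s => /eqP e.
  by rewrite !expr_div_n -mulrDl e -exprMn divff// expf_neq0.
rewrite /ray ![v * s * _]mulrC !divfK// /s.
by case: u {pu g s s0 vs0} => -[t x] y /=; congr (_, _, _); ring.
Qed.

Lemma unit_angle (R : realType) (c d : R) : c ^+ 2 + d ^+ 2 = 1 ->
  exists a, cos a = c /\ sin a = d.
Proof.
move=> cd; have c1 : -1 <= c <= 1 by apply/andP; split; nra.
have e : Num.sqrt (1 - c ^+ 2) = `|d|.
  by rewrite -cd addrAC subrr add0r sqrtr_sqr.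
have [d0|d0] := leP 0 d.
  exists (acos c); rewrite acosK ?in_itv//= sin_acos// e ger0_norm//.
exists (- acos c); rewrite cosN sinN acosK ?in_itv//= sin_acos// e.
by rewrite ltr0_norm// opprK.
Qed.

Lemma rim_curve_continuous (R : realType) (v : R) (p q : pt R) :
  0 < v -> nondegenerate v p q ->
  continuous_coords
    (fun a => ray v p (cos a) (sin a) (rim_time v p q (cos a) (sin a))).
Proof.
move=> v0 pr.
have ct : continuous (fun a : R => rim_time v p q (cos a) (sin a)).
  move=> a; apply: cvgM; first exact: cvg_cst.
  apply: cvgV; first by rewrite gt_eqF ?rim_denom ?cos2Dsin2.
  apply: cvgM; first exact: cvg_cst.
  apply: cvgB; first exact: cvg_cst.
  apply: cvgD; apply: cvgM; try exact: cvg_cst.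
    exact: continuous_cos.
  exact: continuous_sin.
split=> a; apply: cvgD; try exact: cvg_cst; try exact: ct.
  apply: cvgM; last exact: continuous_cos.
  by apply: cvgM; [exact: cvg_cst|exact: ct].
apply: cvgM; last exact: continuous_sin.
by apply: cvgM; [exact: cvg_cst|exact: ct].
Qed.

(* The rim is connected, so it cannot enter the other bead without meeting
   its mantel. *)
Lemma rim_outside (R : realType) (v v' : R) (p q p' q' : pt R) (c d : R) :
  0 < v -> 0 < v' -> nondegenerate v p q -> rim_apart v p q v' p' q' ->
  c ^+ 2 + d ^+ 2 = 1 ->
  ~ inbead v' p' q' (ray v p c d (rim_time v p q c d)) ->
  forall u, inbead v p q u -> gap v p u = 0 -> gap (- v) q u = 0 ->
    ~ inbead v' p' q' u.
Proof.
move=> v0 v'0 pr ra cd out u [_ _ /andP[pu uq]] g1 g2 inu.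
(* A rim point at the apex [p] would force [dist p q = v * (tm q - tm p)]. *)
have pu' : tm p < tm u.
  apply: (@inbead_first _ v p q); first by split; rewrite ?g1 ?g2 ?pu.
  move=> e; move: g2 pr; rewrite e gapE /nondegenerate distC => h1 h2.
  by move: h1; lra.
have [c' [d' [cd' eu]]] := gap0_ray v0 pu' g1.
have es := rim_ray v0 pr cd' eu uq g2.
have [a [ac ad]] := unit_angle cd; have [b [bc bd]] := unit_angle cd'.
pose g a := ray v p (cos a) (sin a) (rim_time v p q (cos a) (sin a)).
have gb : inbead v' p' q' (g b) by rewrite /g bc bd -es -eu.
have ga : ~ inbead v' p' q' (g a) by rewrite /g ac ad.
(* Between the angle [b] inside the other bead and the angle [a] outside it, the rim meets a cone of
   that bead. *)
have [x [x1 x2 _]] := bead_exit v'0 (rim_curve_continuous v0 pr) gb ga.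
have [r1 r2 r3] := ray_rim v0 pr (cos2Dsin2 x).
by case: (ra _ r1 x1 r2 r3) => l1 l2; case: x2 => x2; move: l1 l2;
  rewrite x2 ltxx.
Qed.

(** * The crossing configuration *)

(** The equality case of the triangle inequality: the inner product equals [r * s], so [s] times the
    first vector minus [r] times the second has norm zero. *)
Lemma norm_sum_eq (R : realType) (r s a b c d : R) :
  r ^+ 2 = a ^+ 2 + c ^+ 2 -> s ^+ 2 = b ^+ 2 + d ^+ 2 ->
  (r + s) ^+ 2 = (a + b) ^+ 2 + (c + d) ^+ 2 -> s * a = r * b /\ s * c = r * d.
Proof.
move=> h1 h2 h3; have dot : a * b + c * d = r * s by lra.
have : (s * a - r * b) ^+ 2 + (s * c - r * d) ^+ 2 = 0.
  transitivity (s ^+ 2 * (a ^+ 2 + c ^+ 2) + r ^+ 2 * (b ^+ 2 + d ^+ 2)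
    - 2 * r * s * (a * b + c * d)); first by ring.
  by rewrite dot -h1 -h2; ring.
move/eqP; rewrite paddr_eq0 ?sqr_ge0// !sqrf_eq0 !subr_eq0.
by case/andP => /eqP-> /eqP->.
Qed.

(** The proportion is multiplied out, so that it also covers [p] and [q] at the same place. *)
Lemma tangent_collinear (R : realType) (p u q : pt R) :
  dist p u + dist u q = dist p q ->
  dist p q * (u.1.2 - p.1.2) = dist p u * (q.1.2 - p.1.2) /\
  dist p q * (u.2 - p.2) = dist p u * (q.2 - p.2).
Proof.
move=> e; have [] := @norm_sum_eq R (dist p u) (dist u q)
  (u.1.2 - p.1.2) (q.1.2 - u.1.2) (u.2 - p.2) (q.2 - u.2).
- exact: enorm_sqr.
- exact: enorm_sqr.
- by rewrite e enorm_sqr; congr (_ ^+ 2 + _ ^+ 2); ring.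
by rewrite -e => k1 k2; split; lra.
Qed.

(** The time of [u] cancels in the sum of the gaps; the triangle inequality does the rest. *)
Lemma gap_nondegenerate (R : realType) (v : R) (p q u : pt R) :
  gap v p u + gap (- v) q u < 0 -> nondegenerate v p q.
Proof.
by have := dist_tri p q u; rewrite /nondegenerate !gapE (distC u); lra.
Qed.

(** By tangency [m] lies between [p1] and [p4] in the plane. The rim point in the opposite direction
    has moved away from [p4], to distance [D + v1 * s], which exceeds the radius of the upper cone
    of [p4] at that time. *)
Lemma touch_rim_outside (R : realType) (v1 v2 : R) (p1 p2 p3 p4 m : pt R) :
  0 <= v2 -> v2 < v1 -> tm p1 < tm m ->
  bottom_upper_touch v1 p1 p2 v2 p3 p4 m ->
  exists c d, c ^+ 2 + d ^+ 2 = 1 /\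
    ~ inbead v2 p3 p4 (ray v1 p1 c d (rim_time v1 p1 p2 c d)).
Proof.
move=> v20 v21 a1 [m1 m2 m3 m4 dd].
have v10 : 0 < v1 by apply: le_lt_trans v21.
have pr : nondegenerate v1 p1 p2.
  by apply: (@gap_nondegenerate _ _ _ _ m); rewrite m1 add0r.
have [c [d [cd em]]] := gap0_ray v10 a1 m1.
exists (- c), (- d); rewrite !sqrrN; split=> //; set s := rim_time _ _ _ _ _.
have s0 : 0 < s by apply: rim_time_gt0 => //; rewrite !sqrrN.
case=> _ + _; rewrite gapE distC.
have := unit_dot_le (p4.1.2 - (ray v1 p1 (- c) (- d) s).1.2)
  (p4.2 - (ray v1 p1 (- c) (- d) s).2) cd.
rewrite -/(dist _ p4).
move: m1 m4; rewrite !gapE => m1 m4.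
have [] := @tangent_collinear R p1 m p4; first by rewrite (distC m); lra.
set D := dist p1 p4 in dd *; have D0 : 0 <= D := dist_ge0 _ _.
have -> : dist p1 m = v1 * (tm m - tm p1) by lra.
set T := tm m - tm p1 in em dd *; have T0 : 0 < T by rewrite subr_gt0.
have vT : 0 < v1 * T by rewrite mulr_gt0.
rewrite [in X in X -> _]em [in X in _ -> X -> _]em /ray /= => e1 e2.
have k1 : p4.1.2 - p1.1.2 = D * c.
  by apply: (mulfI (lt0r_neq0 vT)); rewrite -e1; ring.
have k2 : p4.2 - p1.2 = D * d.
  by apply: (mulfI (lt0r_neq0 vT)); rewrite -e2; ring.
have -> : c * (p4.1.2 - (p1.1.2 + v1 * s * - c)) +
   d * (p4.2 - (p1.2 + v1 * s * - d)) = D + v1 * s.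
  transitivity (c * (p4.1.2 - p1.1.2) + d * (p4.2 - p1.2)
    + v1 * s * (c ^+ 2 + d ^+ 2)); first by ring.
  rewrite k1 k2; transitivity ((D + v1 * s) * (c ^+ 2 + d ^+ 2)); first by ring.
  by rewrite cd mulr1.
have vs : 0 < v1 * s by rewrite mulr_gt0.
have vs2 : 0 <= v2 * s by rewrite mulr_ge0 // ltW.
have vT2 : 0 < (v1 - v2) * T by rewrite mulr_gt0 ?subr_gt0.
rewrite /T in dd vT2 *; lra.
Qed.

(** Here [m] plays the role of the highest point. The generator from [p3] through [m] heads for [p2]
    at speed [v2], while the upper cone of [p2] shrinks at the greater speed [v1]. After [m] the
    generator is therefore outside that cone. *)
Lemma upper_touch_rim_outside (R : realType) (v1 v2 : R)
    (p1 p2 p3 p4 m : pt R) :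
  0 < v2 -> v2 < v1 -> tm p3 < tm m ->
  gap (- v1) p2 m = 0 -> gap v2 p3 m = 0 -> gap (- v2) p4 m < 0 ->
  dist p2 p3 = v2 * (tm m - tm p3) - v1 * (tm m - tm p2) ->
  exists c d, c ^+ 2 + d ^+ 2 = 1 /\
    ~ inbead v1 p1 p2 (ray v2 p3 c d (rim_time v2 p3 p4 c d)).
Proof.
move=> v20 v21 a3 m2 m3 m4 dd.
have pr : nondegenerate v2 p3 p4.
  by apply: (@gap_nondegenerate _ _ _ _ m); rewrite m3 add0r.
have [c [d [cd em]]] := gap0_ray v20 a3 m3.
exists c, d; split=> //; set s := rim_time _ _ _ _ _.
have s0 : 0 < s by exact: rim_time_gt0.
have [_ _ r2] := ray_rim v20 pr cd; rewrite -/s in r2.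
set T := tm m - tm p3 in em dd *; have T0 : 0 < T by rewrite subr_gt0.
(* If the generator met the upper cone of [p4] no later than at [m], then [m], which is strictly
   inside that cone and reached from the meeting point at speed [v2], would force the meeting point
   strictly inside as well. *)
have sT : T < s.
  rewrite ltNge; apply/negP => sT.
  move: r2 m4; rewrite !gapE => r2 m4.
  have := dist_tri p4 (ray v2 p3 c d s) m.
  have -> : dist m (ray v2 p3 c d s) = v2 * (T - s).
    apply/enorm_eq; first by rewrite mulr_ge0 ?subr_ge0 // ltW.
    rewrite [in X in X = _]em /ray /=.
    transitivity (v2 ^+ 2 * (T - s) ^+ 2 * (c ^+ 2 + d ^+ 2)); first by ring.
    by rewrite cd mulr1 exprMn.
  have er : tm (ray v2 p3 c d s) = tm p3 + s by [].
  by rewrite er in r2; rewrite /T => h; lra.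
case=> _ + _; rewrite gapE distC.
have := unit_dot_le (p2.1.2 - (ray v2 p3 c d s).1.2)
  (p2.2 - (ray v2 p3 c d s).2) cd.
rewrite -/(dist _ p2).
move: m2 m3; rewrite !gapE => m2 m3; rewrite distC in dd.
have [] := @tangent_collinear R p3 m p2.
  by rewrite (distC m); rewrite /T in dd m3; lra.
set D := dist p3 p2 in dd *; have D0 : 0 <= D := dist_ge0 _ _.
have -> : dist p3 m = v2 * T by rewrite /T; lra.
have vT : 0 < v2 * T by rewrite mulr_gt0.
rewrite [in X in X -> _]em [in X in _ -> X -> _]em /ray /= => e1 e2.
have k1 : p2.1.2 - p3.1.2 = D * c.
  by apply: (mulfI (lt0r_neq0 vT)); rewrite -e1; ring.
have k2 : p2.2 - p3.2 = D * d.
  by apply: (mulfI (lt0r_neq0 vT)); rewrite -e2; ring.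
have -> : c * (p2.1.2 - (p3.1.2 + v2 * s * c)) +
   d * (p2.2 - (p3.2 + v2 * s * d)) = D - v2 * s.
  transitivity (c * (p2.1.2 - p3.1.2) + d * (p2.2 - p3.2)
    - v2 * s * (c ^+ 2 + d ^+ 2)); first by ring.
  rewrite k1 k2; transitivity ((D - v2 * s) * (c ^+ 2 + d ^+ 2)); first by ring.
  by rewrite cd mulr1.
have vT2 : 0 < (v1 - v2) * (s - T) by rewrite mulr_gt0 ?subr_gt0.
rewrite /T in dd vT2 *; lra.
Qed.

(** * Rim planes inside the beads *)

Definition rim_avoids (R : realType) (v : R) (p q : pt R)
    (v' : R) (p' q' : pt R) : Prop :=
  forall u, inbead v p q u -> gap v p u = 0 -> gap (- v) q u = 0 ->
    ~ inbead v' p' q' u.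

Lemma mix0 (R : realType) (u u' : pt R) : mix u u' 0 = u.
Proof.
by rewrite /mix subr0 !mul1r !mul0r !addr0; case: u => -[].
Qed.

Lemma mix1 (R : realType) (u u' : pt R) : mix u u' 1 = u'.
Proof.
by rewrite /mix subrr !mul1r !mul0r !add0r; case: u' => -[].
Qed.

(** The segment from [a] to [b] stays on the rim plane and in the other bead; leaving the first bead
    along it would produce a rim point in the other bead. *)
Lemma rim_plane_section (R : realType) (v v' : R) (p q p' q' a b : pt R) :
  0 < v -> rim_avoids v p q v' p' q' ->
  rim_plane v p q a = 0 -> rim_plane v p q b = 0 ->
  inbead v' p' q' a -> inbead v' p' q' b -> inbead v p q a -> inbead v p q b.
Proof.
move=> v0 av ha hb a' b' ia; apply: contrapT => nb.
have [] := @bead_exit R v p q (mix a b) 0 1 v0 (mix_continuous a b).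
- by rewrite mix0.
- by rewrite mix1.
move=> e [ie /rim_plane_rim r /(_ ler01) e01].
have [] := r (ltW v0) ie.
  by rewrite rim_plane_mix ha hb !mulr0 addr0.
move=> g1 g2; apply: (av _ ie g1 g2); exact: inbead_mix.
Qed.

Lemma mix_zero (R : realType) (f f' : R) : f < 0 -> 0 < f' ->
  exists2 e, 0 < e < 1 & (1 - e) * f + e * f' = 0.
Proof.
move=> f0 f'0; have d0 : 0 < f' - f by lra.
exists (- f / (f' - f)).
  by rewrite ltr_pdivlMr// ltr_pdivrMr//; apply/andP; split; lra.
have : - f / (f' - f) * (f' - f) = - f by rewrite divfK// gt_eqF.
lra.
Qed.

(** By Cauchy-Schwarz the spatial part of the increment is smaller than its time part: motion at
    speed at most [v] crosses a rim plane only upwards. *)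
Lemma rim_plane_mono (R : realType) (v v' : R) (p q u u' : pt R) :
  0 < v -> v' <= v -> nondegenerate v p q -> tm u < tm u' ->
  dist u u' <= v' * (tm u' - tm u) ->
  rim_plane v p q u < rim_plane v p q u'.
Proof.
move=> v0 v'v pr uu' du; rewrite -subr_gt0.
have -> : rim_plane v p q u' - rim_plane v p q u =
  2 * (v * (tm u' - tm u) * (v * (tm q - tm p))
    - ((u'.1.2 - u.1.2) * (q.1.2 - p.1.2) + (u'.2 - u.2) * (q.2 - p.2))).
  by rewrite /rim_plane /cone2; ring.
rewrite mulr_gt0// subr_gt0.
apply: le_lt_trans (enorm_dot _ _ _ _) _.
rewrite -/(dist u u') -/(dist p q).
have d0 := dist_ge0 p q; rewrite /nondegenerate in pr.
have t0 : 0 < tm u' - tm u by rewrite subr_gt0.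
apply: (@le_lt_trans _ _ (v * (tm u' - tm u) * dist p q)).
  by rewrite ler_wpM2r// (le_trans du)// ler_wpM2r// ltW.
by rewrite ltr_pM2l// mulr_gt0.
Qed.

Lemma rim_plane_apexl (R : realType) (v : R) (p q : pt R) :
  nondegenerate v p q -> rim_plane v p q p < 0.
Proof.
move=> pr; have d0 := dist_ge0 p q; rewrite /nondegenerate in pr.
have -> : rim_plane v p q p = dist p q ^+ 2 - (v * (tm q - tm p)) ^+ 2.
  by rewrite /dist enorm_sqr /rim_plane /cone2; ring.
by rewrite subr_lt0 ltr_sqr ?nnegrE// (le_trans d0)// ltW.
Qed.

Lemma rim_plane_apexr (R : realType) (v : R) (p q : pt R) :
  nondegenerate v p q -> 0 < rim_plane v p q q.
Proof.
move=> pr; have := rim_plane_apexl pr.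
rewrite /rim_plane /cone2 !subrr; lra.
Qed.

Lemma inbead_apexl (R : realType) (v : R) (p q : pt R) :
  0 < v -> nondegenerate v p q -> inbead v p q p.
Proof.
move=> v0 pr; apply/inbeadE => //; rewrite gap_self; split=> //.
by rewrite gapE distC; rewrite /nondegenerate in pr; lra.
Qed.

Lemma inbead_apexr (R : realType) (v : R) (p q : pt R) :
  0 < v -> nondegenerate v p q -> inbead v p q q.
Proof.
move=> v0 pr; apply/inbeadE => //; rewrite gap_self; split=> //.
by rewrite gapE; rewrite /nondegenerate in pr; lra.
Qed.

Lemma inbead_dist (R : realType) (v : R) (p q u : pt R) :
  inbead v p q u -> dist p u <= v * (tm q - tm p).
Proof.
by case=> h1 h2 _; have := dist_ge0 q u; move: h1 h2; rewrite !gapE; lra.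
Qed.

Definition line (R : realType) (u : pt R) (t a b s : R) : pt R :=
  (tm u + s * t, u.1.2 + s * a, u.2 + s * b).

Lemma line_continuous (R : realType) (u : pt R) (t a b : R) :
  continuous_coords (line u t a b).
Proof.
have aff (x y : R) : continuous (fun s : R => x + s * y).
  move=> s; apply: cvgD; first exact: cvg_cst.
  by apply: cvgM; [exact: cvg_id|exact: cvg_cst].
by split; exact: aff.
Qed.

Lemma line0 (R : realType) (u : pt R) (t a b : R) : line u t a b 0 = u.
Proof. by rewrite /line !mul0r !addr0; case: u => -[]. Qed.

Lemma inbead_line (R : realType) (v : R) (p q u : pt R) (t a b s s' : R) :
  inbead v p q u -> 0 <= s <= s' -> inbead v p q (line u t a b s') ->
  inbead v p q (line u t a b s).
Proof.
move=> iu /andP[s0 ss'] is'.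
have [e|s'0] := eqVneq s' 0.
  have -> : s = 0 by apply/eqP; rewrite eq_le s0 -e ss'.
  by rewrite line0.
have s'p : 0 < s' by rewrite lt_def s'0 (le_trans s0).
have -> : line u t a b s = mix u (line u t a b s') (s / s').
  have e : s / s' * s' = s by rewrite divfK.
  rewrite /line /mix /=; move: (s / s') e => k <-.
  by congr (_, _, _); ring.
apply: inbead_mix => //.
by rewrite divr_ge0//= ?ler_pdivrMr ?mul1r// ltW.
Qed.

Lemma line_exit (R : realType) (v : R) (p q u : pt R) (t a b : R) :
  0 < v -> inbead v p q u -> 0 < enorm a b ->
  exists s, [/\ 0 <= s, inbead v p q (line u t a b s) &
    gap v p (line u t a b s) = 0 \/ gap (- v) q (line u t a b s) = 0].
Proof.
move=> v0 iu n0; set V := v * (tm q - tm p).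
have V0 : 0 <= V := le_trans (dist_ge0 _ _) (inbead_dist iu).
(* Points of the bead are at most [2 * V] apart in the plane, so a displacement of [2 * V + 1]
   leaves it. *)
set S := (2 * V + 1) / enorm a b.
have S0 : 0 <= S by rewrite divr_ge0 ?ltW//; lra.
have nS : ~ inbead v p q (line u t a b S).
  move=> /inbead_dist h; have h' := inbead_dist iu.
  have := dist_tri u (line u t a b S) p; rewrite (distC u p).
  have -> : dist u (line u t a b S) = 2 * V + 1.
    rewrite /dist /line /= [X in enorm X]addrC [X in enorm _ X]addrC !addKr.
    by rewrite enormZ// divfK// gt_eqF.
  by rewrite -/V in h h'; lra.
have [|s [s1 s2 /(_ S0)/andP[s0 _]]] :=
  bead_exit (a := 0) (b := S) v0 (line_continuous u t a b) _ nS.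
  by rewrite line0.
by exists s.
Qed.

Lemma rim_plane_line (R : realType) (v : R) (p q u : pt R) (t a b s : R) :
  rim_plane v p q (line u t a b s) = rim_plane v p q u + 2 * s *
    (v ^+ 2 * (tm q - tm p) * t
     - (a * (q.1.2 - p.1.2) + b * (q.2 - p.2))).
Proof. by rewrite /rim_plane /cone2 /line /=; ring. Qed.

(** Eliminating [t] leaves one linear equation for the pair of [a] and [b], solved by a
    perpendicular vector, or by any vector if the equation is trivial. A nonzero spatial part is
    what [line_exit] requires. *)
Lemma common_direction (R : realType) (k k' x y x' y' : R) :
  0 < k -> 0 < k' ->
  exists t a b, [/\ 0 < enorm a b, k * t = a * x + b * y &
    k' * t = a * x' + b * y'].
Proof.
move=> k0 k'0.
have [a [b [n0 g]]] : exists a b, 0 < enorm a b /\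
    a * (k' * x - k * x') + b * (k' * y - k * y') = 0.
  set gx := k' * x - _; set gy := k' * y - _.
  have [n|n] := leP (enorm gx gy) 0.
    have [-> ->] := enorm_eq0 n; exists 1, 0; split; last by ring.
    by rewrite /enorm expr0n addr0 expr1n sqrtr1.
  exists (- gy), gx; split; last by ring.
  by rewrite /enorm sqrrN addrC.
exists ((a * x + b * y) / k), a, b; split=> //.
  by rewrite mulrC divfK// gt_eqF.
apply: (mulfI (lt0r_neq0 k0)); rewrite mulrCA [k * _]mulrC divfK ?gt_eqF//.
lra.
Qed.

(* Follow the line in which the two rim planes meet until it leaves the first
   of the two beads: it does so through the rim of that bead. *)
Lemma rim_planes_disjoint (R : realType) (v1 v2 : R) (p1 p2 p3 p4 u : pt R) :
  0 < v1 -> 0 < v2 -> nondegenerate v1 p1 p2 -> nondegenerate v2 p3 p4 ->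
  rim_avoids v1 p1 p2 v2 p3 p4 -> rim_avoids v2 p3 p4 v1 p1 p2 ->
  inbead v1 p1 p2 u -> inbead v2 p3 p4 u ->
  rim_plane v1 p1 p2 u = 0 -> rim_plane v2 p3 p4 u = 0 -> False.
Proof.
move=> v10 v20 pr1 pr2 av1 av2 u1 u2 h1 h2.
have k0 v p q : 0 < v -> nondegenerate v p q -> 0 < v ^+ 2 * (tm q - tm p) :> R.
  move=> v0 pr; rewrite expr2 -mulrA mulr_gt0//.
  exact: le_lt_trans (dist_ge0 _ _) pr.
have [t [a [b [n0 e1 e2]]]] := common_direction (p2.1.2 - p1.1.2) (p2.2 - p1.2)
  (p4.1.2 - p3.1.2) (p4.2 - p3.2) (k0 _ _ _ v10 pr1) (k0 _ _ _ v20 pr2).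
have [s [s0 is1 gs]] := line_exit t v10 u1 n0.
have [s' [s'0 is2 gs']] := line_exit t v20 u2 n0.
have hs : rim_plane v1 p1 p2 (line u t a b s) = 0.
  by rewrite rim_plane_line h1 e1 subrr mulr0 addr0.
have hs' : rim_plane v2 p3 p4 (line u t a b s') = 0.
  by rewrite rim_plane_line h2 e2 subrr mulr0 addr0.
have [r1 r2] := rim_plane_rim (ltW v10) is1 hs gs.
have [r3 r4] := rim_plane_rim (ltW v20) is2 hs' gs'.
have [ss'|ss'] := leP s s'.
  by apply: (av1 _ is1 r1 r2); apply: inbead_line is2; rewrite ?s0.
by apply: (av2 _ is2 r3 r4); apply: inbead_line is1; rewrite ?s'0 ?ltW.
Qed.

(* Bead 1 would have to cross bead 2 from side to side: entering through its
   own bottom cone at [m] and leaving through its own upper cone at [M]. *)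
Lemma no_crossing (R : realType) (v1 v2 : R) (p1 p2 p3 p4 m M : pt R) :
  0 <= v2 -> v2 < v1 -> rim_apart v1 p1 p2 v2 p3 p4 ->
  rim_apart v2 p3 p4 v1 p1 p2 ->
  inbead v1 p1 p2 m -> inbead v2 p3 p4 m ->
  inbead v1 p1 p2 M -> inbead v2 p3 p4 M ->
  tm p1 < tm m -> tm m <= tm M ->
  bottom_upper_touch v1 p1 p2 v2 p3 p4 m ->
  gap v1 p1 M < 0 -> gap (- v1) p2 M = 0 -> gap v2 p3 M = 0 ->
  gap (- v2) p4 M < 0 ->
  dist p2 p3 = v2 * (tm M - tm p3) - v1 * (tm M - tm p2) -> False.
Proof.
move=> v20 v21 ra1 ra2 m_1 m_2 M_1 M_2 a1 mM tch M1 M2 M3 M4 dd.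
have [m1 m2 m3 m4 _] := tch.
have v10 : 0 < v1 by apply: le_lt_trans v21.
have pr1 : nondegenerate v1 p1 p2.
  by apply: (@gap_nondegenerate _ _ _ _ m); rewrite m1 add0r.
have pr2 : nondegenerate v2 p3 p4.
  by apply: (@gap_nondegenerate _ _ _ _ M); rewrite M3 add0r.
have causal u u' : gap v2 u u' < 0 -> 0 < v2 * (tm u' - tm u).
  by move=> h; have := dist_ge0 u u'; move: h; rewrite gapE; lra.
have v20' : 0 < v2.
  by rewrite lt_def v20 andbT; apply/eqP => e; have := causal _ _ m3;
    rewrite e mul0r ltxx.
have causal3 u : gap v2 p3 u < 0 -> tm p3 < tm u.
  by move/causal; rewrite pmulr_rgt0// subr_gt0.
have causal4 u : gap (- v2) p4 u < 0 -> tm u < tm p4.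
  rewrite gapE distC => h; have := dist_ge0 u p4 => d0.
  by rewrite -subr_gt0 -(pmulr_rgt0 _ v20'); lra.
have av1 : rim_avoids v1 p1 p2 v2 p3 p4.
  have [c [d [cd out]]] := touch_rim_outside v20 v21 a1 tch.
  exact: rim_outside cd out.
have av2 : rim_avoids v2 p3 p4 v1 p1 p2.
  have a3 : tm p3 < tm M := lt_le_trans (causal3 _ m3) mM.
  have [c [d [cd out]]] := @upper_touch_rim_outside _ _ _ p1 _ _ _ _ v20' v21 a3
    M2 M3 M4 dd.
  exact: rim_outside cd out.
have apart v p q u : 0 <= v -> inbead v p q u ->
    0 <= v * (tm u - tm p) /\ 0 <= - v * (tm u - tm q) :> R.
  by move=> v0 [_ _ /andP[? ?]]; split; nra.
have [m1' m2'] := apart _ _ _ _ (ltW v10) m_1.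
have [m3' m4'] := apart _ _ _ _ v20 m_2.
have [M1' M2'] := apart _ _ _ _ (ltW v10) M_1.
have [M3' M4'] := apart _ _ _ _ v20 M_2.
(* In each bead exactly one cone is active at [m] and the opposite one at [M]; this fixes all four
   signs. *)
have h1m : rim_plane v1 p1 p2 m < 0.
  rewrite /rim_plane (cone2_eq0 m1').1// subr0 -cone2N; exact: cone2_lt0.
have h1M : 0 < rim_plane v1 p1 p2 M.
  rewrite /rim_plane -(cone2N v1 p2) (cone2_eq0 M2').1// sub0r oppr_gt0.
  exact: cone2_lt0.
have h2m : 0 < rim_plane v2 p3 p4 m.
  rewrite /rim_plane -(cone2N v2 p4) (cone2_eq0 m4').1// sub0r oppr_gt0.
  exact: cone2_lt0.
have h2M : rim_plane v2 p3 p4 M < 0.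
  rewrite /rim_plane (cone2_eq0 M3').1// subr0 -cone2N; exact: cone2_lt0.
have [e /andP[e0 e1] he] := mix_zero h1m h1M; set c := mix m M e.
have e01 : 0 <= e <= 1 by rewrite !ltW.
have c3 : gap v2 p3 c < 0 by apply: le_lt_trans (gap_mix _ _ _ _ e01) _; nra.
have c4 : gap (- v2) p4 c < 0.
  by apply: le_lt_trans (gap_mix _ _ _ _ e01) _; nra.
have h1c : rim_plane v1 p1 p2 c = 0 by rewrite rim_plane_mix.
(* As [c] is strictly inside both cones of the second bead, [p3], [c] and [p4] follow each other at
   speed at most [v2], hence at most [v1]. So the first rim plane, which contains [c], separates
   [p3] from [p4]. *)
have h13 : rim_plane v1 p1 p2 p3 < 0.
  rewrite -h1c; apply: rim_plane_mono (ltW v21) _ _ _ => //.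
    exact: causal3.
  by move: c3; rewrite gapE; lra.
have h14 : 0 < rim_plane v1 p1 p2 p4.
  rewrite -h1c; apply: rim_plane_mono (ltW v21) _ _ _ => //.
    exact: causal4.
  by move: c4; rewrite gapE distC; lra.
(* Both [d] and [d'] lie on the first rim plane. The second plane has [p3] and [M] on one side and
   [m] and [p4] on the other, so it meets the segment from [d] to [d'] in a point [w]. *)
have [f /andP[f0 f1] hf] := mix_zero h13 h1M; set d := mix p3 M f.
have [g /andP[g0 g1] hg] := mix_zero h1m h14; set d' := mix m p4 g.
have h23 := rim_plane_apexl pr2; have h24 := rim_plane_apexr pr2.
have h2d : rim_plane v2 p3 p4 d < 0 by rewrite rim_plane_mix; nra.
have h2d' : 0 < rim_plane v2 p3 p4 d' by rewrite rim_plane_mix; nra.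
have [k /andP[k0 k1] hk] := mix_zero h2d h2d'; set w := mix d d' k.
have h1w : rim_plane v1 p1 p2 w = 0.
  by rewrite rim_plane_mix /d /d' !rim_plane_mix hf hg !mulr0 addr0.
have h2w : rim_plane v2 p3 p4 w = 0 by rewrite rim_plane_mix.
have w2 : inbead v2 p3 p4 w.
  apply: inbead_mix; first by rewrite !ltW.
    by apply: inbead_mix => //; [rewrite !ltW|exact: inbead_apexl].
  by apply: inbead_mix => //; [rewrite !ltW|exact: inbead_apexr].
have w1 : inbead v1 p1 p2 w.
  apply: (rim_plane_section v10 av1 h1c h1w _ w2).
    exact: inbead_mix.
  exact: inbead_mix.
exact: (rim_planes_disjoint v10 v20' pr1 pr2 av1 av2 w1 w2).
Qed.

(** * Mantels, compactness and time reversal *)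

(** Moving a point of a cone along the first spatial axis, away from the apex of that cone, makes
    the gap positive at once. *)
Lemma bead_boundary (R : realType) (tp xp yp tq xq yq v : R) (u : pt R) :
  0 <= v -> inbead v (tp, xp, yp) (tq, xq, yq) u ->
  gap v (tp, xp, yp) u = 0 \/ gap (- v) (tq, xq, yq) u = 0 ->
  boundary (bead tp xp yp tq xq yq v) u.
Proof.
move=> v0 iu gu; split; first by apply: subset_closure; exact/beadP.
have out w p : gap w p u = 0 -> exists2 a, a ^+ 2 = 1 &
    forall e, 0 < e -> 0 < gap w p (line u 0 a 0 e).
  move=> g; set a := (if p.1.2 <= u.1.2 then 1 else -1) : R.
  exists a => [|e e0]; first by rewrite /a; case: ifP; rewrite ?sqrrN expr1n.
  have lt : (u.1.2 - p.1.2) ^+ 2 + (u.2 - p.2) ^+ 2 <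
      (u.1.2 + e * a - p.1.2) ^+ 2 + (u.2 - p.2) ^+ 2.
    have ee := mulr_gt0 e0 e0; rewrite ltrD2r /a.
    case: (leP p.1.2 u.1.2) => [|/ltW]; rewrite -subr_ge0 => h;
      have := mulr_ge0 (ltW e0) h; lra.
  rewrite -[ltLHS]g /gap /line /= !mulr0 !addr0 ltrD2r ltr_sqrt//.
  by rewrite (le_lt_trans _ lt)// addr_ge0 ?sqr_ge0.
rewrite /interior => /= nu.
have escape a : (forall e, 0 < e -> ~ inbead v (tp, xp, yp) (tq, xq, yq)
    (line u 0 a 0 e)) -> False.
  move=> esc; have cl : {for (0 : R), continuous (line u 0 a 0 : R -> pt R)}.
    have [c1 c2 c3] := line_continuous u 0 a 0.
    exact: (cvg_pair (cvg_pair (c1 0) (c2 0)) (c3 0)).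
  have /cl : nbhs (line u 0 a 0 0) (bead tp xp yp tq xq yq v) by rewrite line0.
  move=> /nbhs_ballP[e /= e0 be]; apply: (esc (e / 2)).
    by rewrite divr_gt0.
  apply/beadP => //; apply: be; rewrite /ball /= sub0r normrN ger0_norm; lra.
case: gu => /out[a _ pos]; apply: (escape a) => e /pos;
  rewrite ltNge => /negP n.
- by case.
- by case.
Qed.

(** The two cone equations give the plane equation of [bead_rim]; an active cone of the other bead
    would put the point on its mantel. *)
Lemma bead_rim_apart (R : realType) (tp xp yp tq xq yq v : R)
    (tp' xp' yp' tq' xq' yq' v' : R) :
  0 <= v -> 0 <= v' ->
  bead_rim tp xp yp tq xq yq v
    `&` boundary (bead tp' xp' yp' tq' xq' yq' v') = set0 ->
  rim_apart v (tp, xp, yp) (tq, xq, yq) v' (tp', xp', yp') (tq', xq', yq').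
Proof.
move=> v0 v'0 d u iu iu' g1 g2.
have nb : gap v' (tp', xp', yp') u = 0 \/ gap (- v') (tq', xq', yq') u = 0 ->
    False.
  move=> /(bead_boundary v'0 iu') b; suff : set0 u by [].
  rewrite -d; split=> //; have [_ _ hu] := iu; have /andP[h1 h2] := hu.
  have s1 : 0 <= v * (tm u - tp) by rewrite mulr_ge0 ?subr_ge0.
  have s2 : 0 <= - v * (tm u - tq).
    by rewrite mulNr -mulrN opprB mulr_ge0 ?subr_ge0.
  have := (@cone2_eq0 _ v (tp, xp, yp) u s1).1 g1.
  have := (@cone2_eq0 _ (- v) (tq, xq, yq) u s2).1 g2.
  rewrite cone2N; case: u hu {d iu iu' g1 g2 b h1 h2 s1 s2} => -[t x] y /= hu.
  by rewrite /cone2 /= => c2 c1; split=> //; lra.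
have [l1 l2 _] := iu'; move: l1 l2; rewrite !le_eqVlt.
case/predU1P => [e|->]; first by case: nb; left.
by case/predU1P => [e|->]; first by case: nb; right.
Qed.

(** Exchanges bottom and upper cones, and turns highest points into lowest ones. *)
Definition time_rev (R : realType) (u : pt R) : pt R := (- tm u, u.1.2, u.2).

Lemma time_revK (R : realType) : involutive (@time_rev R).
Proof. by case=> -[t x] y; rewrite /time_rev /= opprK. Qed.

Lemma gap_rev (R : realType) (w : R) (p u : pt R) :
  gap w (time_rev p) (time_rev u) = gap (- w) p u.
Proof. by rewrite /gap /time_rev /=; congr (_ - _); ring. Qed.

Lemma inbead_rev (R : realType) (v : R) (p q u : pt R) :
  inbead v (time_rev q) (time_rev p) (time_rev u) <-> inbead v p q u.
Proof.
rewrite /inbead !gap_rev opprK /time_rev /= !lerN2.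
by split=> -[? ? /andP[? ?]]; split=> //; apply/andP.
Qed.

Lemma rim_apart_rev (R : realType) (v v' : R) (p q p' q' : pt R) :
  rim_apart v p q v' p' q' ->
  rim_apart v (time_rev q) (time_rev p) v' (time_rev q') (time_rev p').
Proof.
move=> ra u; rewrite -(time_revK u) !inbead_rev !gap_rev !opprK => i1 i2 g1 g2.
by have [] := ra _ i1 i2 g2 g1.
Qed.

(** A closed subset of a box whose spatial half-width comes from [inbead_dist]. *)
Lemma bead_compact (R : realType) (v : R) (p q : pt R) :
  compact [set u | inbead v p q u].
Proof.
set V := v * (tm q - tm p).
apply: (@subclosed_compact _ _ (`[tm p, tm q] `*` `[p.1.2 - V, p.1.2 + V]
    `*` `[p.2 - V, p.2 + V])).
- have cid : @continuous_coords R (pt R) id.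
    split=> u; last exact: cvg_snd.
      exact: (continuous_comp (@cvg_fst _ _ _ _ _) (@cvg_fst _ _ _ _ _)).
    exact: (continuous_comp (@cvg_fst _ _ _ _ _) (@cvg_snd _ _ _ _ _)).
  have [ct _ _] := cid.
  rewrite (_ : [set _ | _] = (gap v p @^-1` [set x | x <= 0])
    `&` (gap (- v) q @^-1` [set x | x <= 0])
    `&` ((fun u : pt R => tm u) @^-1` `[tm p, tm q])).
    apply: closedI; [apply: closedI|].
    + by apply: closed_comp => [u _|]; [exact: gap_continuous|exact: closed_le].
    + by apply: closed_comp => [u _|]; [exact: gap_continuous|exact: closed_le].
    + by apply: closed_comp => [u _|]; [exact: ct|exact: itv_closed].
  apply/seteqP; split=> u /=; rewrite in_itv /=; first by case.
  by case=> -[].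
- by apply: compact_setX; [apply: compact_setX|]; exact: segment_compact.
- move=> u iu; have d := inbead_dist iu; have [_ _ h] := iu.
  rewrite /= !in_itv /= h.
  have e := enorm_sqr (u.1.2 - p.1.2) (u.2 - p.2); rewrite -/(dist p u) in e.
  have d0 := dist_ge0 p u; rewrite -/V in d.
  have := sqr_ge0 (u.1.2 - p.1.2); have := sqr_ge0 (u.2 - p.2) => sy sx.
  have bnd z : z ^+ 2 <= dist p u ^+ 2 -> - V <= z <= V.
    rewrite -ler_norml -[z ^+ 2]real_normK ?num_real// ler_sqr ?nnegrE//.
    by move=> /le_trans; apply.
  have /andP[] : - V <= u.1.2 - p.1.2 <= V by apply: bnd; lra.
  have /andP[] : - V <= u.2 - p.2 <= V by apply: bnd; lra.
  by move=> *; split; [split|] => //; apply/andP; split; lra.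
Qed.

Lemma exists_lowest_common (R : realType) (v1 v2 : R) (p1 p2 p3 p4 u : pt R) :
  inbead v1 p1 p2 u -> inbead v2 p3 p4 u ->
  exists m, lowest_common v1 v2 p1 p2 p3 p4 m.
Proof.
move=> i1 i2.
have cK : compact ([set u | inbead v1 p1 p2 u] `&` [set u | inbead v2 p3 p4 u]).
  have cB v p q : closed [set u : pt R | inbead v p q u].
    by apply: compact_closed; [exact: norm_hausdorff|exact: bead_compact].
  apply: (@subclosed_compact (pt R) _ [set u | inbead v1 p1 p2 u]).
  - by apply: closedI; exact: cB.
  - exact: bead_compact.
  - exact: subIsetl.
have ct : continuous (fun u : pt R => tm u).
  move=> w; exact: (continuous_comp (@cvg_fst _ _ _ _ _) (@cvg_fst _ _ _ _ _)).
have [||m] := compact_EVT_min (f := fun u : pt R => tm u) _ cK.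
- by exists u.
- exact: continuous_subspaceT.
rewrite inE => -[m1 m2] mm; exists m; split=> // w w1 w2.
by apply: mm; rewrite inE.
Qed.

(** As [v1 + v2] is positive, the sum of the radii is strictly increasing, which determines the time
    of tangency; collinearity with the centres then determines the place. *)
Lemma touch_unique (R : realType) (v1 v2 : R) (p1 p3 m u : pt R) :
  0 <= v1 -> 0 <= v2 -> 0 < v1 + v2 ->
  gap v1 p1 m = 0 -> gap v2 p3 m = 0 ->
  dist p1 p3 = v1 * (tm m - tm p1) + v2 * (tm m - tm p3) ->
  gap v1 p1 u = 0 -> gap v2 p3 u = 0 -> tm p1 <= tm u -> tm p3 <= tm u ->
  (v1 * (tm u - tm p1) + v2 * (tm u - tm p3)) ^+ 2 = dist p1 p3 ^+ 2 -> u = m.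
Proof.
move=> v10 v20 vp m1 m3 md u1 u3 t1 t3 sq.
have D0 := dist_ge0 p1 p3.
have ud : dist p1 p3 = v1 * (tm u - tm p1) + v2 * (tm u - tm p3).
  by apply/esym/eqP; rewrite -(@eqrXn2 _ 2) ?sq// addr_ge0//
    mulr_ge0// subr_ge0.
have tu : tm u = tm m.
  by apply: (mulfI (lt0r_neq0 vp)); move: ud; rewrite md; lra.
move: m1 m3 u1 u3; rewrite !gapE tu => m1 m3 u1 u3; rewrite tu in ud.
have [] := @tangent_collinear R p1 m p3; first by rewrite (distC m); lra.
have [] := @tangent_collinear R p1 u p3; first by rewrite (distC u); lra.
have -> : dist p1 u = dist p1 m by lra.
move=> ex ey fx fy.
have [[kx ky]] : u.1.2 = m.1.2 /\ u.2 = m.2; last first.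
  by case: u m tu kx ky {ex ey fx fy m1 m3 u1 u3 md ud sq t1 t3}
    => -[t x] y [[t' x'] y'] /= -> -> ->.
(* Coincident centres force both radii to be zero, so both points sit at the centre. *)
have [d0|d0] := eqVneq (dist p1 p3) 0; last first.
  by rewrite -fx in ex; rewrite -fy in ey; split;
    apply: (addIr (- _)); [exact: (mulfI d0 ex)|exact: (mulfI d0 ey)].
have z w : dist p1 w <= 0 -> w.1.2 = p1.1.2 /\ w.2 = p1.2.
  by case/enorm_eq0 => /eqP + /eqP; rewrite !subr_eq0 => /eqP-> /eqP->.
have e3 := dist_ge0 p3 u; have e3' := dist_ge0 p3 m.
have [-> ->] : u.1.2 = p1.1.2 /\ u.2 = p1.2 by apply: z; lra.
by have [-> ->] : m.1.2 = p1.1.2 /\ m.2 = p1.2 by apply: z; lra.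
Qed.

Lemma bottom_IC_eq (R : realType) (s1 a1 b1 w1 s2 a2 b2 w2 : R) (m : pt R) :
  0 <= w1 -> 0 <= w2 -> 0 < w1 + w2 ->
  gap w1 (s1, a1, b1) m = 0 -> gap w2 (s2, a2, b2) m = 0 ->
  dist (s1, a1, b1) (s2, a2, b2) = w1 * (tm m - s1) + w2 * (tm m - s2) ->
  forall u, bottom_IC s1 a1 b1 w1 s2 a2 b2 w2 u -> u = m.
Proof.
move=> w10 w20 wp m1 m2 md [[t x] y] [[[c1 l1] [c2 l2]] /= tt].
apply: (@touch_unique R w1 w2 (s1, a1, b1) (s2, a2, b2)) => //=.
- by apply/cone2_eq0; rewrite /cone2 /= ?mulr_ge0 ?subr_ge0//; lra.
- by apply/cone2_eq0; rewrite /cone2 /= ?mulr_ge0 ?subr_ge0//; lra.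
- by rewrite /dist enorm_sqr /=; lra.
Qed.

Lemma upper_IC_rev (R : realType) (s1 a1 b1 w1 s2 a2 b2 w2 : R) (u : pt R) :
  upper_IC s1 a1 b1 w1 s2 a2 b2 w2 u ->
  bottom_IC (- s1) a1 b1 w1 (- s2) a2 b2 w2 (time_rev u).
Proof.
case: u => -[t x] y [[[c1 l1] [c2 l2]] /= tt].
by split; [split; split; rewrite /= ?lerN2//; lra|rewrite /=; lra].
Qed.

(** * Combining the lowest and the highest common point *)

Unset Implicit Arguments.

Theorem theorem1 (R : realType)
    (t1 x1 y1 t2 x2 y2 t3 x3 y3 t4 x4 y4 v1 v2 : R) :
  t1 <= t2 -> t3 <= t4 -> 0 <= v1 -> 0 <= v2 ->
  let B1 := bead t1 x1 y1 t2 x2 y2 v1 in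
  let B2 := bead t3 x3 y3 t4 x4 y4 v2 in
  let tauB1 := bead_apexes t1 x1 y1 t2 x2 y2 in
  let tauB2 := bead_apexes t3 x3 y3 t4 x4 y4 in
  let rhoB1 := bead_rim t1 x1 y1 t2 x2 y2 v1 in
  let rhoB2 := bead_rim t3 x3 y3 t4 x4 y4 v2 in
  B1 !=set0 ->
  B2 !=set0 ->
  B1 `&` B2 !=set0 ->
  tauB1 `&` B2 = set0 ->
  B1 `&` tauB2 = set0 ->
  rhoB1 `&` boundary B2 = set0 ->
  rhoB2 `&` boundary B1 = set0 ->
  bottom_IC t1 x1 y1 v1 t3 x3 y3 v2 `<=` B1 `&` B2 \/
  upper_IC t2 x2 y2 v1 t4 x4 y4 v2 `<=` B1 `&` B2.
Proof.
move=> t12 t34 v10 v20 B1 B2 tauB1 tauB2 rhoB1 rhoB2.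
pose p1 : pt R := (t1, x1, y1); pose p2 : pt R := (t2, x2, y2).
pose p3 : pt R := (t3, x3, y3); pose p4 : pt R := (t4, x4, y4).
have B1P u : B1 u <-> inbead v1 p1 p2 u by exact: beadP.
have B2P u : B2 u <-> inbead v2 p3 p4 u by exact: beadP.
move=> _ _ [u [/B1P u1 /B2P u2]] ap1 ap2 r1 r2.
have ra1 : rim_apart v1 p1 p2 v2 p3 p4 by exact: bead_rim_apart r1.
have ra2 : rim_apart v2 p3 p4 v1 p1 p2 by exact: bead_rim_apart r2.
have a1 p : p = p1 \/ p = p2 -> ~ inbead v2 p3 p4 p.
  by move=> pe /B2P ip; suff : set0 p by []; rewrite -ap1; split.
have a3 p : p = p3 \/ p = p4 -> ~ inbead v1 p1 p2 p.
  by move=> pe /B1P ip; suff : set0 p by []; rewrite -ap2; split.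
have n v p q w : inbead v p q w -> gap (- v) q p <= 0 /\ gap v p q <= 0 :> R.
  case; rewrite !gapE (distC q p) (distC q w) => h1 h2 _.
  by have := dist_tri p q w; split; lra.
have [n1 n1'] := n _ _ _ _ u1; have [n2 n2'] := n _ _ _ _ u2.
have [m lm] := exists_lowest_common u1 u2.
have [m1 m2 mmin] := lm.
(* The highest common point is the time reverse of a lowest one for the reversed beads. *)
have [M lM] : exists M, lowest_common v1 v2 (time_rev p2) (time_rev p1)
    (time_rev p4) (time_rev p3) (time_rev M).
  have [||M' lM'] := @exists_lowest_common R v1 v2 (time_rev p2)
    (time_rev p1) (time_rev p4) (time_rev p3) (time_rev u).
  - exact/inbead_rev.
  - exact/inbead_rev.
  by exists (time_rev M'); rewrite time_revK.
have [/inbead_rev M1 /inbead_rev M2 _] := lM.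
have in12 w : inbead v1 p1 p2 w -> inbead v2 p3 p4 w -> (B1 `&` B2) w.
  by move=> w1 w2; split; [apply/B1P|apply/B2P].
have mM : tm m <= tm M by exact: mmin.
have first1 : tm p1 < tm m.
  by apply: inbead_first m1 _ => e; apply: (a1 p1); [left|rewrite -e].
have first3 : tm p3 < tm m.
  by apply: inbead_first m2 _ => e; apply: (a3 p3); [left|rewrite -e].
have low := lowest_cases v10 v20 lm (a1 _ (or_introl erefl))
  (a3 _ (or_introl erefl)) n1 n2 ra1 ra2.
have high : [\/ [/\ 0 < v1 + v2, gap v1 (time_rev p2) (time_rev M) = 0,
      gap v2 (time_rev p4) (time_rev M) = 0 & dist (time_rev p2) (time_rev p4) =
        v1 * (tm (time_rev M) - tm (time_rev p2)) +
        v2 * (tm (time_rev M) - tm (time_rev p4))],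
    v2 < v1 /\ bottom_upper_touch v1 (time_rev p2) (time_rev p1)
      v2 (time_rev p4) (time_rev p3) (time_rev M)
  | v1 < v2 /\ bottom_upper_touch v2 (time_rev p4) (time_rev p3)
      v1 (time_rev p2) (time_rev p1) (time_rev M)].
  apply: lowest_cases => //; try exact: rim_apart_rev.
  - by move/inbead_rev; apply: a1; right.
  - by move/inbead_rev; apply: a3; right.
  - by rewrite gap_rev opprK.
  - by rewrite gap_rev opprK.
(* A contact of two bottom cones at [m], or of two upper cones at [M], gives the corresponding
   inclusion. Otherwise both points are touches of the mixed kind, with the same bead the faster one
   at both, and [no_crossing] applies. *)
case: high => [[vp g2 g4 dd]|[v21 tchM]|[v12 tchM]].
- right=> w /upper_IC_rev /(bottom_IC_eq v10 v20 vp g2 g4 dd)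
    /(congr1 (@time_rev R)).
  by rewrite !time_revK => ->; exact: in12.
- case: low => [[vp g1 g3 dd]|[_ tch]|[]]; last by rewrite ltNge ltW.
    by left=> w /(bottom_IC_eq v10 v20 vp g1 g3 dd) ->; exact: in12.
  case: tchM; rewrite !gap_rev !opprK => M2' M1' M4' M3' dd.
  exfalso; apply: (no_crossing v20 v21 ra1 ra2 m1 m2 M1 M2 first1 mM tch) => //.
  by move: dd; rewrite /dist /=; lra.
- case: low => [[vp g1 g3 dd]|[]|[_ tch]]; last first.
  + case: tchM; rewrite !gap_rev !opprK => M4' M3' M2' M1' dd.
    exfalso.
    apply: (no_crossing v10 v12 ra2 ra1 m2 m1 M2 M1 first3 mM tch) => //.
    by move: dd; rewrite /dist /=; lra.
  + by rewrite ltNge ltW.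
  by left=> w /(bottom_IC_eq v10 v20 vp g1 g3 dd) ->; exact: in12.
Qed.
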